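(* Let $X$ be a real Banach space which is an $L_1$-predual. Then, for every pair of metric spaces $N\subseteq M$, every Lipschitz compact function $f:N\to X$ and every $\varepsilon>0$, there exists a Lipschitz compact function $F:M\to X$ such that (1) $F(x)=f(x)$ for every $x\in N$, and (2) $\Vert F\Vert\leq(1+\varepsilon)\Vert f\Vert$.
   Context: All Banach spaces are real; metric spaces are nonempty, and $N\subseteq M$ means that $N$ is a subset of the metric space $M$ with the restricted metric. A Banach space $X$ is an $L_1$-predual if $X^*$ is linearly isometric to $L_1(\mu)$ for some measure $\mu$. For a Lipschitz function $f:M\to X$ from a metric space $(M,d)$ to a Banach space $X$, $\Vert f\Vert$ denotes its best Lipschitz constant, $\Vert f\Vert:=\sup\{\Vert f(x)-f(y)\Vert/d(x,y): x,y\in M,\ x\neq y\}$ (equal to $0$ if $M$ is a single point). A Lipschitz function $f:M\to X$ is called compact (a ''Lipschitz compact function'') if the set $\{(f(x)-f(y))/d(x,y): x,y\in M,\ x\neq y\}$ is relatively compact in $X$. *)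

(* Defs.v *)
From HB Require Import structures.
From mathcomp Require Import all_boot all_order all_algebra.
From mathcomp Require Import all_classical all_reals all_analysis.

Set Implicit Arguments.
Unset Strict Implicit.
Unset Printing Implicit Defensive.

Import Order.TTheory GRing.Theory Num.Theory.
Import numFieldNormedType.Exports.

Local Open Scope classical_set_scope.
Local Open Scope ring_scope.

Definition topological_dual (R : realType) (X : normedModType R) : set (X -> R^o) :=
  [set f | linear f /\ continuous f].
Arguments topological_dual {R} X _.

Definition dual_norm (R : realType) (X : normedModType R) (f : X -> R^o) : R :=
  sup [set `|f x| | x in [set x : X | `|x| <= 1]].

Definition L1_norm d (T : measurableType d) (R : realType)
    (mu : {measure set T -> \bar R}) (g : LspaceType1 mu) : R :=
  fine 'N[mu]_1[EFin \o g].

(* [LspaceType1 mu] is the quotient of the integrable functions by equality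
   [mu]-almost everywhere, and carries no algebraic structure in the library:
   the vector space operations of L_1(mu) are those of representatives up to
   [mu]-a.e. equality, which is how linearity of [Phi] is expressed.
   Only the values of [Phi] on the dual matter; its injectivity there follows
   from the isometry condition. *)
Definition L1_predual (R : realType) (X : completeNormedModType R) : Prop :=
  exists (d : measure_display) (T : measurableType d)
    (mu : {measure set T -> \bar R}) (Phi : (X -> R^o) -> LspaceType1 mu),
  [/\ forall (a : R) (f g : X -> R^o), topological_dual X f -> topological_dual X g ->
        ae_eq mu setT (Phi (a *: f + g)) (fun t => a * Phi f t + Phi g t),
      forall f, topological_dual X f -> L1_norm (Phi f) = dual_norm f
    & forall h : LspaceType1 mu, exists2 f, topological_dual X f & Phi f = h].

(* In the definitions below only the values of [f] on [A] matter: [f] stands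
   for a function from the subspace [A] of [M] to [X]. *)

Definition slopes (R : realType) (M : metricType R) (X : normedModType R)
    (A : set M) (f : M -> X) : set X :=
  [set v | exists x y : M,
    [/\ A x, A y, x <> y & v = (mdist x y)^-1 *: (f x - f y)]].

(* [sup set0 = 0], so this is [0] when [A] is a singleton. *)
Definition lipschitz_norm (R : realType) (M : metricType R)
    (X : normedModType R) (A : set M) (f : M -> X) : R :=
  sup [set `|v| | v in slopes A f].

Definition is_lipschitz (R : realType) (M : metricType R)
    (X : normedModType R) (A : set M) (f : M -> X) : Prop :=
  exists k : R, forall x y, A x -> A y -> `|f x - f y| <= k * mdist x y.

Definition lipschitz_compact (R : realType) (M : metricType R)
    (X : normedModType R) (A : set M) (f : M -> X) : Prop :=
  is_lipschitz A f /\ precompact (slopes A f).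

(* Main.v *)
(* Since X^* is an L_1 space, conditional expectations onto step functions give
   finite-rank contractions of X^* of the form f |-> sum_i m_i(f) phi_i with
   |phi_i| <= 1 and sum_i |m_i(f)| <= |f|, almost fixing any finite set of
   functionals. By a Hahn-Banach duality argument this yields, for every finite
   subset of X, an operator sum_i phi_i(.) e_i on X almost fixing that subset with
   |phi_i| <= 1 and |sum_i a_i e_i| <= 1 + eps whenever all |a_i| <= 1. Applied to
   a finite net of the slopes of f, and extending each scalar function phi_i o f
   by McShane's formula, it gives a finite-rank G on M with Lipschitz constant at
   most (1 + eps)|f| such that f - G has an arbitrarily small constant on N.
   Iterating on f - G and summing a geometric series gives the extension; its
   slopes are uniform limits of totally bounded sets of slopes. *)
Require Import Defs.
From HB Require Import structures.
From mathcomp Require Import all_boot all_order all_algebra.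
From mathcomp Require Import all_classical all_reals all_analysis.
From mathcomp Require Import measurable_realfun.
From mathcomp Require Import ring lra.

Set Implicit Arguments.
Unset Strict Implicit.
Unset Printing Implicit Defensive.

Import Order.TTheory GRing.Theory Num.Theory.
Import numFieldNormedType.Exports.

Local Open Scope classical_set_scope.
Local Open Scope ring_scope.

(** The coefficients of a conditional expectation are functionals on the dual of X, that is,
    elements of the bidual, so the expectation need not come from an operator on X. The passage to X
    goes through convexity. For a fixed family x in X^J, a sublinear gauge on X^J measures how well
    a family is approximated by operator images of x: the constant on the cube plus a large multiple
    of the error. A supporting functional of the gauge at x has coordinates in the dual, and the
    expectation is made to almost fix these coordinates rather than the vectors of x. This bounds
    the functional at x, hence the gauge of x, by 1.

    The sharp constant matters only for the first approximant of f. The remainder on N can be made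
    so small that a fixed factor lost in extending it is absorbed by the allowed excess, so the
    later steps may be wasteful. *)

(** * Hahn-Banach theorem for sublinear functionals *)

Definition sublinear (R : realType) (V : lmodType R) (p : V -> R) : Prop :=
  (forall a x, 0 < a -> p (a *: x) <= a * p x) /\
  (forall x y, p (x + y) <= p x + p y).

Definition pack_linear (R : realType) (V W : lmodType R) (f : V -> W)
    (lf : linear f) : {linear V -> W} :=
  HB.pack f (GRing.isLinear.Build _ _ _ _ f lf).

Lemma linear_funZ (R : realType) (V : lmodType R) (f : V -> R^o) a x :
  linear f -> f (a *: x) = a * f x.
Proof.
move=> lf; have := lf a x 0; rewrite addr0 => ->.
by have /= -> := linear0 (pack_linear lf); rewrite addr0.
Qed.

Section HahnBanach.
Variables (R : realType) (V : lmodType R).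
Implicit Types (p q : V -> R) (C : set (V * R)).

Lemma sublinear0 p : sublinear p -> p 0 = 0.
Proof.
move=> [ph pd]; have h := pd 0 0; have h2 := ph 2^-1 0.
rewrite scaler0 in h2; rewrite addr0 in h.
have /h2 : (0 : R) < 2^-1 by rewrite invr_gt0.
lra.
Qed.

Lemma sublinearN p x : sublinear p -> - p (- x) <= p x.
Proof.
by move=> sp; have := sp.2 x (- x); rewrite subrr sublinear0//; lra.
Qed.

Definition convex_cone C := [/\ C (0, 0),
  (forall c c', C c -> C c' -> C (c + c')) &
  (forall a c, 0 < a -> C c -> C (a *: c.1, a * c.2))].

(* A linear functional below [inf_cone p C] is below [p] and takes at least the
   value [c.2] at [c.1] for every [c] in [C]. *)
Definition inf_cone p C (v : V) : R := inf [set p (v + c.1) - c.2 | c in C].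

Lemma has_inf_cone p C v : sublinear p -> convex_cone C ->
  (forall c, C c -> c.2 <= p c.1) -> has_inf [set p (v + c.1) - c.2 | c in C].
Proof.
move=> sp [C0 _ _] Cp; split; first by exists (p (v + 0) - 0); exists (0, 0).
exists (- p (- v)) => _ [c Cc <-].
have := sp.2 (v + c.1) (- v); rewrite addrAC subrr add0r.
by have := Cp _ Cc; lra.
Qed.

Lemma inf_cone_le p C v c : sublinear p -> convex_cone C ->
  (forall c, C c -> c.2 <= p c.1) -> C c -> inf_cone p C v <= p (v + c.1) - c.2.
Proof.
move=> sp cC Cp Cc; have [_ lb] := has_inf_cone v sp cC Cp.
by apply: ge_inf => //; exists c.
Qed.

Lemma le_inf_cone p C v b : convex_cone C ->
  (forall c, C c -> b <= p (v + c.1) - c.2) -> b <= inf_cone p C v.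
Proof.
move=> [C0 _ _] bC; apply: lb_le_inf; first by exists (p (v + 0) - 0); exists (0, 0).
by move=> _ [c Cc <-]; exact: bC.
Qed.

Lemma inf_cone_sublinear p C : sublinear p -> convex_cone C ->
  (forall c, C c -> c.2 <= p c.1) -> sublinear (inf_cone p C).
Proof.
move=> sp cC Cp; have [C0 CD CZ] := cC; split.
- move=> a x a0; rewrite -ler_pdivrMl//; apply: le_inf_cone => // c Cc.
  rewrite ler_pdivrMl//.
  apply: le_trans (inf_cone_le _ sp cC Cp (CZ _ _ a0 Cc)) _ => /=.
  by rewrite -scalerDr mulrBr lerB// sp.1.
- move=> x y; rewrite -lerBlDr; apply: le_inf_cone => // c Cc; rewrite lerBlDr -lerBlDl.
  apply: le_inf_cone => // c' Cc'; rewrite lerBlDr.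
  apply: le_trans (inf_cone_le _ sp cC Cp (CD _ _ Cc Cc')) _ => /=.
  rewrite addrACA; have := sp.2 (x + c.1) (y + c'.1); lra.
Qed.

(** Zorn's lemma for the reversed pointwise order. The infimum of a chain is finite because of the
    lower bound [- p (- x)], and it stays subadditive because the smaller of two members of a chain
    serves for both arguments. *)
Lemma minimal_sublinear p : sublinear p -> exists q, [/\ sublinear q,
  forall x, q x <= p x &
  forall r, sublinear r -> (forall x, r x <= q x) -> r = q].
Proof.
move=> sp.
pose T := {q : V -> R | sublinear q /\ forall x, q x <= p x}.
pose le (q r : T) : bool := `[< forall x, sval r x <= sval q x >].
have [|||A tA|t tmax] := @Zorn T le.
- by move=> t; apply/asboolP.
- move=> r s t /asboolP rs /asboolP st; apply/asboolP => x.
  exact: le_trans (st x) (rs x).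
- move=> s t /asboolP st /asboolP ts; case: s t st ts => [s sP] [t tP] /= st ts.
  have e : s = t by apply/funext => x; apply/eqP; rewrite eq_le ts st.
  by move: sP tP; rewrite e => sP tP; congr exist; exact: Prop_irrelevance.
- have [[a Aa]|A0] := pselect (exists a, A a); last first.
    exists (exist _ p (conj sp (fun x => lexx _))) => s As.
    by exfalso; apply: A0; exists s.
  pose q x := inf [set sval s x | s in A].
  have hi x : has_inf [set sval s x | s in A].
    split; first by exists (sval a x); exists a.
    exists (- p (- x)) => _ [[s [ss sP]] _ <-] /=.
    by have := sublinearN x ss; have := sP (- x); lra.
  have qle s x : A s -> q x <= sval s x.
    by move=> As; apply: ge_inf; [exact: (hi x).2|exists s].
  have sq : sublinear q.
    split=> [b x b0|x y].
      rewrite -ler_pdivrMl//; apply: lb_le_inf; first exact: (hi x).1.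
      move=> _ [s As <-]; rewrite ler_pdivrMl//.
      exact: le_trans (qle _ _ As) ((svalP s).1.1 _ _ b0).
    rewrite -lerBlDr; apply: lb_le_inf; first exact: (hi x).1.
    move=> _ [s As <-]; rewrite lerBlDr -lerBlDl.
    apply: lb_le_inf; first exact: (hi y).1.
    move=> _ [s' As' <-]; rewrite lerBlDr.
    have [/asboolP h|/asboolP h] := tA _ _ As As'.
    - apply: le_trans (qle _ _ As') _; apply: le_trans ((svalP s').1.2 _ _) _.
      by rewrite addrC lerD2l.
    - apply: le_trans (qle _ _ As) _; apply: le_trans ((svalP s).1.2 _ _) _.
      by rewrite addrC lerD2r.
  have qp x : q x <= p x by apply: le_trans (qle _ _ Aa) _; exact: (svalP a).2.
  exists (exist _ q (conj sq qp)) => s As; apply/asboolP => x /=; exact: qle.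
- case: t tmax => [q [sq qp]] tmax; exists q; split => // r sr rq.
  have rp x : r x <= p x by exact: le_trans (rq x) (qp x).
  have := tmax (exist _ r (conj sr rp)).
  have h : le (exist _ q (conj sq qp)) (exist _ r (conj sr rp)) by apply/asboolP.
  by move=> /(_ h) /(congr1 sval).
Qed.

(** A minimal sublinear [q] is linear: [inf_cone] along the ray through [(y, q y)] lies below [q],
    hence equals it, and its value at [- y] is at most [- q y]. *)
Theorem hahn_banach p : sublinear p ->
  exists l : {linear V -> R^o}, forall x, l x <= p x.
Proof.
move=> sp; have [q [sq qp qmin]] := minimal_sublinear sp.
have q0 := sublinear0 sq.
have qN y : q (- y) = - q y.
  pose C : set (V * R) := [set c | exists2 t, 0 <= t & c = (t *: y, t * q y)].
  have cC : convex_cone C.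
    split; first by exists 0; rewrite // scale0r mul0r.
      move=> _ _ [t t0 ->] [t' t'0 ->]; exists (t + t'); first exact: addr_ge0.
      by rewrite scalerDl mulrDl.
    move=> a _ a0 [t t0 ->]; exists (a * t); first by rewrite mulr_ge0// ltW.
    by rewrite scalerA mulrA.
  have Cq c : C c -> c.2 <= q c.1.
    move=> [t + ->] /=; rewrite le_eqVlt => /predU1P[<-|t0].
      by rewrite scale0r mul0r q0.
    have := sq.1 t^-1 (t *: y); rewrite invr_gt0 => /(_ t0).
    by rewrite scalerA mulVf ?gt_eqF// scale1r ler_pdivlMl.
  have e : inf_cone q C = q.
    apply: qmin; first exact: inf_cone_sublinear.
    have [C0 _ _] := cC => x; have := inf_cone_le x sq cC Cq C0.
    by rewrite /= addr0 subr0.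
  have C1 : C (y, q y) by exists 1; rewrite ?scale1r ?mul1r.
  have := inf_cone_le (- y) sq cC Cq C1; rewrite e /= addNr q0.
  by have := sublinearN y sq; lra.
have qD x y : q (x + y) = q x + q y.
  have := sq.2 x y; have := sq.2 (x + y) (- y); rewrite addrK qN; lra.
have qZ a x : 0 < a -> q (a *: x) = a * q x.
  move=> a0; have h1 := sq.1 _ x a0; have := sq.1 a (- x) a0.
  by rewrite scalerN !qN; lra.
have lq : linear (q : V -> R^o).
  move=> a x y; rewrite qD; congr (_ + _).
  have [a0|a0|->] := ltgtP a 0; last by rewrite !scale0r q0.
    have := qZ (- a) x; rewrite oppr_gt0 scaleNr qN => /(_ a0) h.
    by rewrite -[RHS]/(a * q x); lra.
  exact: qZ.
by exists (pack_linear lq) => x; exact: qp.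
Qed.

(** The cone is the graph of [eta] over [A]. It is closed under negation, so the one-sided bound
    [eta u <= l (A u)] becomes an equality. Working along a map [A] instead of a subspace avoids
    subtypes; the domination by [p] forces [eta] to vanish on the kernel of [A]. *)
Theorem hahn_banach_extension (U : lmodType R) (A : {linear U -> V})
    (eta : {linear U -> R^o}) p : sublinear p ->
  (forall u, eta u <= p (A u)) ->
  exists l : {linear V -> R^o},
    (forall x, l x <= p x) /\ (forall u, l (A u) = eta u).
Proof.
move=> sp etap.
pose C : set (V * R) := [set c | exists u, c = (A u, eta u)].
have cC : convex_cone C.
  split; first by exists 0; rewrite !linear0.
    by move=> _ _ [u ->] [v ->]; exists (u + v); rewrite !linearD.
  by move=> a _ a0 [u ->]; exists (a *: u); rewrite !linearZ.
have Cp c : C c -> c.2 <= p c.1 by move=> [u ->]; exact: etap.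
have [l lP] := hahn_banach (inf_cone_sublinear sp cC Cp).
have h u : eta u <= l (A u).
  have Cu : C (A u, eta u) by exists u.
  have := le_trans (lP (- A u)) (inf_cone_le (- A u) sp cC Cp Cu).
  by rewrite /= addNr sublinear0// linearN; lra.
exists l; split=> [x|u].
  have C0 : C (0, 0) by case: cC.
  apply: le_trans (lP x) _.
  by have := inf_cone_le x sp cC Cp C0; rewrite /= addr0 subr0.
apply/eqP; rewrite eq_le h andbT.
have := h (- u); rewrite !linearN /=; lra.
Qed.

End HahnBanach.

(** * Continuous functionals and the dual norm *)

Section Dual.
Variables (R : realType) (X : completeNormedModType R).
Implicit Types (f g : X -> R^o).

Lemma bounded_dual f r : linear f -> (forall x, `|f x| <= r * `|x|) ->
  topological_dual X f.
Proof.
move=> lf fr; split => //.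
have : bounded_near (pack_linear lf) (nbhs (0 : X)).
  apply/linear_boundedP; near=> s => x; apply: le_trans (fr x) _.
  by apply: ler_wpM2r => //; near: s; exact: nbhs_pinfty_ge.
by move=> /linear_bounded_continuous.
Unshelve. all: by end_near. Qed.

Lemma dual_bounded f : topological_dual X f ->
  exists2 r, 0 < r & forall x, `|f x| <= r * `|x|.
Proof.
move=> [lf cf]; have : continuous (pack_linear lf) by [].
move=> /linear_bounded_continuous/linear_boundedP bf.
near (pinfty_nbhs R) => r; exists r => //.
near: r; exact: bf.
Unshelve. all: by end_near. Qed.

Lemma dual_norm_has_sup f : topological_dual X f ->
  has_sup [set `|f x| | x in [set x : X | `|x| <= 1]].
Proof.
move=> /dual_bounded [r r0 fr]; split.
  by exists `|f 0|; exists 0 => //=; rewrite normr0.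
exists r => _ [x /= x1 <-]; apply: le_trans (fr x) _.
by rewrite -[leRHS]mulr1 ler_pM2l.
Qed.

Lemma dual_normP f x : topological_dual X f -> `|f x| <= dual_norm f * `|x|.
Proof.
move=> Df; have [lf _] := Df; have [_ ub] := dual_norm_has_sup Df.
have [->|x0] := eqVneq x 0.
  by rewrite -(scale0r 0) linear_funZ// mul0r scale0r !normr0 mulr0.
have nx : 0 < `|x| by rewrite normr_gt0.
rewrite -ler_pdivrMr//.
have -> : `|f x| / `|x| = `|f (`|x|^-1 *: x)|.
  by rewrite linear_funZ// normrM normfV normr_id mulrC.
apply: ub_le_sup => //; exists (`|x|^-1 *: x) => //=.
by rewrite normrZ normfV normr_id mulVf ?gt_eqF.
Qed.

Lemma dual_lincomb a f g : topological_dual X f -> topological_dual X g ->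
  topological_dual X (a *: f + g).
Proof.
move=> Df Dg; have [lf _] := Df; have [lg _] := Dg.
apply: (@bounded_dual _ (`|a| * dual_norm f + dual_norm g)).
  move=> b x y; rewrite !fctE lf lg scalerDr scalerDr !scalerA mulrC.
  by rewrite addrACA.
move=> x; rewrite !fctE; apply: le_trans (ler_normD _ _) _.
rewrite mulrDl lerD//; last exact: dual_normP.
by rewrite normrZ -mulrA ler_wpM2l// dual_normP.
Qed.

Lemma dual0 : topological_dual X (0 : X -> R^o).
Proof.
apply: (@bounded_dual _ 0); last first.
  by move=> x; rewrite [X in `|X|](_ : _ = 0)// normr0 mul0r.
by move=> a x y; rewrite [RHS](_ : _ = a *: (0 : R^o) + 0)// scaler0 addr0.
Qed.

Lemma dualB f g : topological_dual X f -> topological_dual X g ->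
  topological_dual X (f - g).
Proof.
by move=> Df Dg; rewrite addrC -scaleN1r; exact: dual_lincomb.
Qed.

Lemma dual_sum (I : Type) (r : seq I) (c : I -> R) (F : I -> X -> R^o) :
  (forall i, topological_dual X (F i)) ->
  topological_dual X (\sum_(i <- r) c i *: F i).
Proof.
move=> DF; elim: r => [|i r IH]; first by rewrite big_nil; exact: dual0.
by rewrite big_cons; exact: dual_lincomb.
Qed.

End Dual.

(** * Integrable functions as representatives of functionals *)

Section L1Representatives.
Context d (T : measurableType d) (R : realType).
Variable mu : {measure set T -> \bar R}.

Lemma integrable_Lspace1 (h : LspaceType1 mu) :
  mu.-integrable setT (EFin \o (h : T -> R)).
Proof.
apply/Lfun1_integrable; rewrite inE; apply/andP; split.
  rewrite inE.
  exact: (@measurable_funPT _ _ _ _ (repr (h : {mfun_ mu, T >-> measurableTypeR R}))).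
by rewrite inE /=; exact: (@Lebesgue_finite _ _ _ _ _ _ h).
Qed.

(** The witness is the class of [g] in the quotient; as a function it is the canonical
    representative of that class, which agrees with [g] only almost everywhere. *)
Lemma Lspace1_of_integrable (g : T -> R) : mu.-integrable setT (EFin \o g) ->
  exists h : LspaceType1 mu, ae_eq mu setT (h : T -> R) g.
Proof.
move=> ig; have mg : measurable_fun setT (g : T -> measurableTypeR R).
  by apply/measurable_EFinP; case/integrableP: ig.
pose g' : {mfun T >-> measurableTypeR R} :=
  HB.pack g (@isMeasurableFun.Build _ _ T (measurableTypeR R) g mg).
pose h0 : {mfun_ mu, T >-> measurableTypeR R} :=
  (\pi_{mfun_ mu, T >-> measurableTypeR R} g')%qT.
have hg : ae_eq mu setT (h0 : T -> R) g.
  have /eqmodP/asboolP : (repr h0 = g' %[mod {mfun_ mu, T >-> measurableTypeR R}])%qT.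
    by rewrite reprK.
  exact.
have h0fin : finite_norm mu 1 (h0 : T -> R).
  rewrite /finite_norm Lnorm1; case/integrableP: ig => _; apply: le_lt_trans.
  apply: ae_ge0_le_integral => //.
  - apply/measurableT_comp => //; apply/measurable_EFinP.
    exact: (@measurable_funPT _ _ _ _ (repr h0)).
  - by apply/measurableT_comp => //; exact/measurable_EFinP.
  - by apply: filterS hg => t /(_ I) /= -> _.
pose h : LspaceType1 mu :=
  HB.pack h0 (isFinLebesgue.Build _ _ _ _ _ (@lexx _ _ 1%E) h0 h0fin).
by exists h.
Qed.
End L1Representatives.

Section L1Predual.
Context d (T : measurableType d) (R : realType) (X : completeNormedModType R).
Variables (mu : {measure set T -> \bar R}) (Phi : (X -> R^o) -> LspaceType1 mu).
Hypothesis Phi_linear : forall (a : R) (f g : X -> R^o),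
  topological_dual X f -> topological_dual X g ->
  ae_eq mu setT (Phi (a *: f + g)) (fun t => a * Phi f t + Phi g t).
Hypothesis Phi_isometry : forall f, topological_dual X f ->
  L1_norm (Phi f) = dual_norm f.
Hypothesis Phi_surjective : forall h : LspaceType1 mu,
  exists2 f, topological_dual X f & Phi f = h.

(* [g] is an honest integrable function in the a.e. class [Phi f]; this keeps the
   quotient type [LspaceType1] out of the computations. *)
Definition represents (f : X -> R^o) (g : T -> R) : Prop :=
  [/\ topological_dual X f, mu.-integrable setT (EFin \o g) &
      ae_eq mu setT (Phi f : T -> R) g].

Lemma represents_self f : topological_dual X f -> represents f (Phi f).
Proof. by move=> Df; split; [|exact: integrable_Lspace1|exact: ae_eq_refl]. Qed.

Lemma represents_ex g : mu.-integrable setT (EFin \o g) ->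
  exists f, represents f g.
Proof.
move=> ig; have [h hg] := Lspace1_of_integrable ig.
by have [f Df fh] := Phi_surjective h; exists f; split; rewrite ?fh.
Qed.

Lemma represents_lincomb a f f' g g' : represents f g -> represents f' g' ->
  represents (a *: f + f') (fun t => a * g t + g' t).
Proof.
move=> [Df ig fg] [Df' ig' fg']; split; first exact: dual_lincomb.
  have := integrableD measurableT (integrableZl measurableT a ig) ig'.
  by apply: eq_integrable.
have := Phi_linear a Df Df'; apply: filterS3 fg fg' => t h h' /(_ I) -> _.
by rewrite h// h'.
Qed.

Lemma represents0 : represents 0 (cst 0).
Proof.
split; [exact: dual0|exact: integrable0|].
(* As [1 *: 0 + 0 = 0], almost everywhere [Phi 0] equals twice itself. *)
have := Phi_linear 1 (@dual0 R X) (@dual0 R X); rewrite scaler0 addr0.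
by apply: filterS => t /(_ I) h _; rewrite /cst; lra.
Qed.

Lemma represents_sum (I : Type) (r : seq I) (c : I -> R) F G :
  (forall i, represents (F i) (G i)) ->
  represents (\sum_(i <- r) c i *: F i) (fun t => \sum_(i <- r) c i * G i t).
Proof.
move=> FG; elim: r => [|i r IH].
  have -> : (fun t => \sum_(i <- [::]) c i * G i t) = cst 0.
    by apply/funext => t; rewrite big_nil.
  by rewrite big_nil; exact: represents0.
have -> : (fun t => \sum_(j <- i :: r) c j * G j t) =
    (fun t => c i * G i t + \sum_(j <- r) c j * G j t).
  by apply/funext => t; rewrite big_cons.
rewrite big_cons; have h := represents_lincomb (c i) (FG i) IH; exact h.
Qed.

Lemma represents_ae f g g' : represents f g -> ae_eq mu setT g g' ->
  mu.-integrable setT (EFin \o g') -> represents f g'.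
Proof. by move=> [Df _ fg] gg' ig'; split => //; exact: ae_eq_trans fg gg'. Qed.

Lemma represents_Rintegral A f g : measurable A -> represents f g ->
  \int[mu]_(t in A) Phi f t = \int[mu]_(t in A) g t.
Proof.
move=> mA [Df ig fg]; congr fine; apply: ae_eq_integral => //.
- by case/integrableP: (integrable_Lspace1 (Phi f)) => h _; exact: measurable_funTS.
- by case/integrableP: ig => h _; exact: measurable_funTS.
- by apply: filterS fg => t h _ /=; rewrite h.
Qed.

Lemma represents_norm f g : represents f g -> dual_norm f = \int[mu]_t `|g t|.
Proof.
move=> [Df ig fg]; rewrite -Phi_isometry// /L1_norm Lnorm1; congr fine.
apply: ae_eq_integral => //.
- apply/measurableT_comp => //.
  by case/integrableP: (integrable_Lspace1 (Phi f)).
- apply/measurable_EFinP/measurableT_comp => //.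
  by case/integrableP: ig => /measurable_EFinP.
- by apply: filterS fg => t h _ /=; rewrite h.
Qed.

End L1Predual.

(** * Step functions and their common cells *)

Section Cells.
Import HBSimple.
Context d (T : measurableType d) (R : realType).
Variable mu : {measure set T -> \bar R}.

Lemma simple_approximation (g : T -> R) (eps : R) : 0 < eps ->
  mu.-integrable setT (EFin \o g) ->
  exists h : T -> R, [/\ measurable_fun setT h, finite_set (range h),
    mu.-integrable setT (EFin \o h) & \int[mu]_t `|g t - h t| <= eps].
Proof.
move=> e0 ig; have [h_ [ih _ /fine_cvgP [_ hcvg]]] :=
  approximation_sfun_integrable measurableT ig.
have : \forall n \near \oo, `|0 - fine (\int[mu]_t `|(EFin \o g) t - (h_ n t)%:E|)| < eps.
  by move/cvgrPdist_lt : hcvg; exact.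
move=> [n _ /(_ n (leqnn n))]; rewrite sub0r normrN => hn.
exists (h_ n); split => //.
by apply: ltW; apply: le_lt_trans hn; exact: ler_norm.
Qed.

(** A cell is labelled by the tuple of values of the [h j] on it, with entries in one finite list
    that contains all the ranges. Labels that do not occur have an empty cell. *)
Lemma joint_cells (J : finType) (h : J -> T -> R) :
  (forall j, measurable_fun setT (h j)) -> (forall j, finite_set (range (h j))) ->
  exists (I : finType) (ix : T -> I) (v : I -> J -> R),
    (forall i, measurable (ix @^-1` [set i])) /\ (forall t j, h j t = v (ix t) j).
Proof.
move=> mh fh; have /choice [s sP] : forall j, exists s : seq R, range (h j) = [set` s].
  by move=> j; apply/finite_seqP.
pose S := flatten [seq s j | j <- enum J].
have hS j t : h j t \in S.
  apply/flattenP; exists (s j); first by apply: map_f; rewrite mem_enum.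
  suff : [set` s j] (h j t) by [].
  by rewrite -sP; exists t.
pose ix t : {ffun J -> seq_sub S} := [ffun j => SeqSub (hS j t)].
exists {ffun J -> seq_sub S}, ix, (fun (i : {ffun J -> seq_sub S}) j => ssval (i j)).
split; last first.
  by move=> t j; rewrite ffunE.
move=> i; have -> : ix @^-1` [set i] =
    \bigcap_(j in [set: J]) (h j @^-1` [set ssval (i j)]).
  apply/seteqP; split => t /=.
    by move=> <- j _ /=; rewrite ffunE.
  move=> ht; apply/ffunP => j; rewrite ffunE; apply/val_inj => /=; exact: ht.
apply: fin_bigcap_measurable => // j _.
by rewrite -[X in measurable X]setTI; exact: mh.
Qed.

Lemma sum_normr_Rintegral_le (I : finType) (ix : T -> I) (g : T -> R) :
  (forall i, measurable (ix @^-1` [set i])) -> mu.-integrable setT (EFin \o g) ->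
  \sum_i `|\int[mu]_(t in ix @^-1` [set i]) g t| <= \int[mu]_t `|g t|.
Proof.
move=> mix ig.
have iA i : mu.-integrable (ix @^-1` [set i]) (EFin \o g).
  exact: integrableS ig.
apply: le_trans (_ : \sum_i \int[mu]_(t in ix @^-1` [set i]) `|g t| <= _).
  by apply: ler_sum => i _; exact: le_normr_Rintegral.
have fin A : measurable A -> (\int[mu]_(t in A) `|g t|%:E)%E \is a fin_num.
  move=> mA; apply: integrable_fin_num => //.
  by apply: (@integrableS _ _ _ _ setT) => //; exact: (integrable_abse ig).
rewrite -lee_fin -sumEFin (eq_bigr (fun i => \int[mu]_(t in ix @^-1` [set i]) `|g t|%:E)%E).
  rewrite -ge0_integral_bigsetU//.
  - rewrite fineK ?fin//; apply: ge0_subset_integral => //.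
    + by apply: bigsetU_measurable.
    + apply/measurable_EFinP/measurableT_comp => //.
      by apply/measurable_EFinP; case/integrableP: ig.
  - exact: index_enum_uniq.
  - by move=> i j _ _ [t [/= <- <-]].
  - apply/measurable_EFinP/measurable_funTS/measurableT_comp => //.
    by apply/measurable_EFinP; case/integrableP: ig.
by move=> i _; rewrite fineK ?fin.
Qed.

End Cells.

(** * Conditional expectation onto the step functions on given cells *)

Section FiniteRankApproximation.
Context d (T : measurableType d) (R : realType) (X : completeNormedModType R).
Variables (mu : {measure set T -> \bar R}) (Phi : (X -> R^o) -> LspaceType1 mu).
Hypothesis Phi_linear : forall (a : R) (f g : X -> R^o),
  topological_dual X f -> topological_dual X g ->
  ae_eq mu setT (Phi (a *: f + g)) (fun t => a * Phi f t + Phi g t).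
Hypothesis Phi_isometry : forall f, topological_dual X f ->
  L1_norm (Phi f) = dual_norm f.
Hypothesis Phi_surjective : forall h : LspaceType1 mu,
  exists2 f, topological_dual X f & Phi f = h.
Variables (I : finType) (ix : T -> I).
Hypothesis measurable_ix : forall i, measurable (ix @^-1` [set i]).

Let A i := ix @^-1` [set i].
Let m i : R := fine (mu (A i)).
(** On these cells [u i] is a density of integral 1. On all others, null or of infinite measure,
    [fine] makes [m i] equal to 0. *)
Let good i := (0 < mu (A i) < +oo)%E.
Let u i : T -> R := (m i)^-1 \o* \1_(A i).

Let mA i : measurable (A i) := measurable_ix i.

Lemma integrable_cell_indicator i : good i -> mu.-integrable setT (EFin \o \1_(A i)).
Proof.
move=> /andP[_ muoo]; apply/integrableP; split.
  exact/measurable_EFinP.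
rewrite (eq_integral (fun t => (\1_(A i) t)%:E)).
  by rewrite integral_indic// setIT.
by move=> t _ /=; rewrite ger0_norm.
Qed.

Lemma integrable_cell i : good i -> mu.-integrable setT (EFin \o u i).
Proof.
move=> gi; have := integrableZl measurableT (m i)^-1 (integrable_cell_indicator gi).
by apply: eq_integrable => // t _ /=; rewrite -EFinM mulrC.
Qed.

Lemma cell_mass_gt0 i : good i -> 0 < m i.
Proof. by move=> /andP[m0 moo]; rewrite fine_gt0// m0. Qed.

Lemma Rintegral_cell i k : good k ->
  \int[mu]_(t in A i) u k t = (i == k)%:R.
Proof.
move=> gk; rewrite (@eq_Rintegral _ _ _ mu _ (fun=> (i == k)%:R / m k)).
  rewrite Rintegral_cst//; have [->|_] := eqVneq i k; last by rewrite !mul0r.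
  by rewrite mul1r mulVf// gt_eqF// cell_mass_gt0.
move=> t; rewrite inE /A /= => ti; rewrite /u /= indicE.
by have -> : (t \in A k) = (i == k) by apply/idP/eqP; rewrite inE /A /= ti.
Qed.

(** The value 0 on discarded cells lets later sums run over all of [I]. *)
Lemma cell_functionals : exists phi : I -> X -> R^o,
  forall i, (good i -> represents Phi (phi i) (u i)) /\ (~~ good i -> phi i = 0).
Proof.
suff /choice [phi phiP] : forall i, exists f : X -> R^o,
  (good i -> represents Phi f (u i)) /\ (~~ good i -> f = 0).
  by exists phi.
move=> i; have [gi|gi] := boolP (good i); last by exists 0.
by have [f fP] := represents_ex Phi_surjective (integrable_cell gi); exists f.
Qed.

Lemma cell_density_norm i : good i -> \int[mu]_t `|u i t| = 1.
Proof.
move=> gi; have m0 := cell_mass_gt0 gi.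
rewrite (@eq_Rintegral _ _ _ mu _ (fun t => (m i)^-1 * \1_(A i) t)); last first.
  by move=> t _; rewrite /u /= ger0_norm 1?mulrC// mulr_ge0// invr_ge0 ltW.
rewrite RintegralZl//; last exact: integrable_cell_indicator.
by rewrite /Rintegral integral_indic// setIT mulVf// gt_eqF.
Qed.

(* An integrable step function lives a.e. on the cells of positive finite measure;
   the other cells are discarded. *)
Definition cell_mean i (f : X -> R^o) : R :=
  if good i then \int[mu]_(t in A i) Phi f t else 0.

Lemma cell_mean_linear i a f g : topological_dual X f -> topological_dual X g ->
  cell_mean i (a *: f + g) = a * cell_mean i f + cell_mean i g.
Proof.
move=> Df Dg; rewrite /cell_mean; case: ifPn => _; last by rewrite mulr0 addr0.
have if_ := integrable_Lspace1 (Phi f); have ig := integrable_Lspace1 (Phi g).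
rewrite (represents_Rintegral (mA i)
  (represents_lincomb Phi_linear a (represents_self Phi Df) (represents_self Phi Dg))).
have ifA : mu.-integrable (A i) (EFin \o (Phi f : T -> R)) by exact: integrableS if_.
have igA : mu.-integrable (A i) (EFin \o (Phi g : T -> R)) by exact: integrableS ig.
rewrite RintegralD ?RintegralZl//.
by have := integrableZl (mA i) a ifA; apply: eq_integrable.
Qed.

Lemma cell_mean_le f : topological_dual X f ->
  \sum_i `|cell_mean i f| <= dual_norm f.
Proof.
move=> Df; have ig := integrable_Lspace1 (Phi f).
rewrite (represents_norm Phi_isometry (represents_self Phi Df)).
apply: le_trans (sum_normr_Rintegral_le measurable_ix ig).
apply: ler_sum => i _; rewrite /cell_mean; case: ifPn => // _.
by rewrite normr0.
Qed.

(** Integrability forces [v] to vanish on cells of infinite measure, and almost every point avoids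
    the finitely many null cells. On a good cell the mass [m i] cancels the normalisation of
    [u i]. *)
Lemma cell_expansion (v : I -> R) :
  mu.-integrable setT (EFin \o (v \o ix)) ->
  ae_eq mu setT (fun t => \sum_(i | good i) v i * m i * u i t) (v \o ix).
Proof.
move=> iv.
have hv i : mu (A i) = +oo%E -> v i = 0.
  move=> moo; apply/eqP; apply/negPn/negP => v0.
  have : mu.-integrable (A i) (EFin \o (v \o ix)) by exact: integrableS iv.
  move=> /integrableP [_]; rewrite (eq_integral (fun=> `|v i|%:E)).
    by rewrite integral_cst// moo mulry gtr0_sg ?normr_gt0// mul1e ltxx.
  by move=> t; rewrite inE /A /= => ->.
have : \forall t \ae mu, forall i, mu (A i) = 0%E -> ~ A i t.
  apply: filter_forall => i; have [m0|m0] := pselect (mu (A i) = 0%E).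
    exists (A i); split => // t /=; apply: contra_notP => Ait h.
    exact: Ait.
  by apply: aeW => t /m0.
apply: filterS => t ht _ /=.
have [gi|bi] := boolP (good (ix t)).
  rewrite (bigD1 (ix t))//= big1 ?addr0 => [|i /andP[_ ii]].
    rewrite /u /= indicE mem_set// mul1r -mulrA mulfV ?mulr1// gt_eqF//.
    exact: cell_mass_gt0.
  rewrite /u /= indicE memNset ?mul0r ?mulr0// => /= e.
  by rewrite e eqxx in ii.
have v0 : v (ix t) = 0.
  apply: hv; apply/eqP; move: bi; rewrite /good negb_and -leye_eq -!leNgt.
  by move=> /orP [m0|//]; case: (ht (ix t)) => //; apply/eqP; rewrite eq_le m0 measure_ge0.
rewrite v0 big1// => i gi; have [e|ii] := eqVneq i (ix t).
  by rewrite e v0 !mul0r.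
rewrite /u /= indicE memNset ?mul0r ?mulr0// => /= e.
by rewrite e eqxx in ii.
Qed.

End FiniteRankApproximation.

Lemma dual_functional_sum (R : realType) (X : completeNormedModType R)
    (m : (X -> R^o) -> R) (J : Type) (r : seq J) (c : J -> R) (F : J -> X -> R^o) :
  (forall a f g, topological_dual X f -> topological_dual X g ->
    m (a *: f + g) = a * m f + m g) ->
  (forall j, topological_dual X (F j)) ->
  m (\sum_(j <- r) c j *: F j) = \sum_(j <- r) c j * m (F j).
Proof.
move=> mlin DF; elim: r => [|k r IH]; last first.
  by rewrite !big_cons mlin ?IH//; exact: dual_sum.
have := mlin 1 _ _ (@dual0 R X) (@dual0 R X).
by rewrite !big_nil scaler0 addr0; lra.
Qed.

Section ContractionOntoSpan.
Variables (R : realType) (X : completeNormedModType R) (I : finType).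
Variables (phi : I -> X -> R^o) (mean : I -> (X -> R^o) -> R).
Hypothesis phi_dual : forall i, topological_dual X (phi i).
Hypothesis phi_norm : forall i, dual_norm (phi i) <= 1.
Hypothesis mean_linear : forall i a f g, topological_dual X f ->
  topological_dual X g -> mean i (a *: f + g) = a * mean i f + mean i g.
Hypothesis mean_norm : forall f, topological_dual X f ->
  \sum_i `|mean i f| <= dual_norm f.
Hypothesis mean_phi : forall i k x, mean i (phi k) * phi i x = (i == k)%:R * phi i x.

(* [f |-> \sum_i mean i f *: phi i] is a contraction fixing the span of the
   [phi i], whence the factor [2]. *)
Lemma mean_approximation f (c : I -> R) x : topological_dual X f ->
  `|f x - \sum_i mean i f * phi i x| <=
    2 * dual_norm (f - \sum_i c i *: phi i) * `|x|.
Proof.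
move=> Df; set k := \sum_i c i *: phi i.
have Dk : topological_dual X k by exact: dual_sum.
have Dg := dualB Df Dk; set g := f - k in Dg *.
have fE : f = 1 *: g + k by rewrite scale1r subrK.
have kx : \sum_i mean i k * phi i x = k x.
  have -> : k x = \sum_i c i * phi i x by rewrite /k fct_sumE.
  apply: eq_bigr => i _.
  rewrite /k (dual_functional_sum _ _ (mean_linear i))// mulr_suml (bigD1 i)//=.
  rewrite -mulrA mean_phi eqxx mul1r.
  rewrite big1 ?addr0// => j ji; rewrite -mulrA mean_phi.
  by rewrite eq_sym (negbTE ji) mul0r mulr0.
have -> : f x - \sum_i mean i f * phi i x = g x - \sum_i mean i g * phi i x.
  have mf i : mean i f = mean i g + mean i k by rewrite {1}fE mean_linear// mul1r.
  under eq_bigr => i _ do rewrite mf mulrDl.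
  have gx : g x = f x - k x by [].
  by rewrite big_split/= kx gx opprD addrA addrAC.
apply: le_trans (ler_normB _ _) _; rewrite -mulrA mulr_natl mulr2n.
apply: lerD; first exact: dual_normP.
apply: le_trans (ler_norm_sum _ _ _) _.
apply: le_trans (_ : \sum_i `|mean i g| * `|x| <= _); last first.
  by rewrite -mulr_suml ler_wpM2r// mean_norm.
apply: ler_sum => i _; rewrite normrM ler_wpM2l//.
apply: le_trans (dual_normP x (phi_dual i)) _.
by rewrite -[leRHS]mul1r ler_wpM2r.
Qed.

End ContractionOntoSpan.

Theorem finite_rank_approximation (R : realType) (X : completeNormedModType R)
    (J : finType) (psi : J -> X -> R^o) (eps : R) :
  L1_predual X -> (forall j, topological_dual X (psi j)) -> 0 < eps ->
  exists (I : finType) (phi : I -> X -> R^o) (mean : I -> (X -> R^o) -> R),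
    [/\ forall i, topological_dual X (phi i), forall i, dual_norm (phi i) <= 1,
        forall i a f g, topological_dual X f -> topological_dual X g ->
          mean i (a *: f + g) = a * mean i f + mean i g,
        forall f, topological_dual X f -> \sum_i `|mean i f| <= dual_norm f &
        forall j x, `|psi j x - \sum_i mean i (psi j) * phi i x| <= eps * `|x|].
Proof.
move=> [d [T [mu [Phi [Plin Piso Psurj]]]]] Dpsi eps0.
(* The other half is consumed by the factor [2] of [mean_approximation]. *)
have e2 : 0 < eps / 2 by rewrite divr_gt0.
have /choice [h hP] j := simple_approximation e2 (integrable_Lspace1 (Phi (psi j))).
have [I [ix [v [mix hv]]]] := joint_cells (fun j => let: And4 a _ _ _ := hP j in a)
  (fun j => let: And4 _ b _ _ := hP j in b).
have vh j : v ^~ j \o ix = h j by apply/funext => t /=; rewrite hv.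
have [phi phiP] := cell_functionals Psurj mix.
set A := fun i => ix @^-1` [set i] in phiP.
set good := fun i => (0 < mu (A i) < +oo)%E.
set u := fun i => (fine (mu (A i)))^-1 \o* \1_(A i) : T -> R.
have rep i : represents Phi (phi i) (if good i then u i else cst 0).
  by case: ifPn => gi; [exact: (phiP i).1|rewrite (phiP i).2//; exact: represents0].
have Dphi i : topological_dual X (phi i) by case: (rep i).
have ml := cell_mean_linear Plin mix; have mle := cell_mean_le Piso mix.
(* On a discarded cell the mean of [phi i] is 0 and not 1; the factor [phi i x], which vanishes
   there, keeps the biorthogonality relation true. *)
have mphi i k x : cell_mean Phi ix i (phi k) * phi i x = (i == k)%:R * phi i x.
  rewrite /cell_mean; case: ifPn => gi; last first.
    by rewrite (phiP i).2// [X in _ * X](_ : _ = 0)// !mulr0.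
  rewrite (represents_Rintegral (mix i) (rep k)); case: ifPn => gk.
    by rewrite Rintegral_cell.
  have [ik|_] := eqVneq i k; first by case/negP: gk; rewrite -ik; exact: gi.
  by rewrite Rintegral_cst// mul0r.
have nphi i : dual_norm (phi i) <= 1.
  rewrite (represents_norm Piso (rep i)); case: ifPn => gi.
    by rewrite cell_density_norm.
  rewrite (@eq_Rintegral _ _ _ mu _ (cst 0)) => [|t _]; last by rewrite /cst normr0.
  by rewrite Rintegral_cst// mul0r.
exists I, phi, (cell_mean Phi ix); split => // j x.
(* [u i] has height [(fine (mu (A i)))^-1], so the value [v i j] on a cell needs the coefficient
   value times mass. *)
pose c i := if good i then v i j * fine (mu (A i)) else 0.
apply: le_trans (mean_approximation Dphi nphi ml mle mphi c x (Dpsi j)) _.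
apply: ler_wpM2r => //; rewrite mulrC -ler_pdivlMr//.
have [_ _ ih hle] := hP j; rewrite -vh in ih hle.
have repk : represents Phi (\sum_i c i *: phi i) (v ^~ j \o ix).
  apply: (represents_ae (represents_sum Plin _ c rep)) => //.
  have := cell_expansion mix ih; apply: filterS => t ht /ht <-.
  rewrite [RHS]big_mkcond/=; apply: eq_bigr => i _; rewrite /c.
  rewrite -/(A i) -/(good i); case: (good i) => //.
  by rewrite mul0r.
have := represents_lincomb Plin (- 1) repk (represents_self Phi (Dpsi j)).
move=> /(represents_norm Piso); rewrite scaleN1r addrC => ->.
by apply: le_trans hle; under eq_Rintegral do rewrite mulN1r addrC.
Qed.

(** * Functionals on finite powers of X, and the vertices of a cube *)

Section Coordinates.
Variables (R : realType) (X : completeNormedModType R) (J : finType).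

Definition single (j : J) (y : X) : J -> X := fun k => if k == j then y else 0.

Lemma single_linear j a y z : single j (a *: y + z) = a *: single j y + single j z.
Proof.
apply/funext => k; rewrite !fctE /single; case: ifP => //.
by rewrite scaler0 addr0.
Qed.

Lemma singleN j y : single j (- y) = - single j y.
Proof.
apply/funext => k; rewrite !fctE /single; case: ifP => // _.
by rewrite oppr0.
Qed.

Lemma linear_coordinates (l : {linear (J -> X) -> R^o}) v :
  l v = \sum_j l (single j (v j)).
Proof.
rewrite -linear_sum; congr (l _); apply/funext => k.
rewrite fct_sumE (bigD1 k)//= /single eqxx big1 ?addr0// => j jk.
by rewrite eq_sym (negbTE jk).
Qed.

Lemma coordinate_dual (l : {linear (J -> X) -> R^o}) (K : R) j :
  (forall v, l v <= K * \sum_k `|v k|) ->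
  topological_dual X (fun y => l (single j y)).
Proof.
move=> lK; have ls y : \sum_k `|single j y k| = `|y|.
  rewrite (bigD1 j)//= /single eqxx big1 ?addr0// => k kj.
  by rewrite (negbTE kj) normr0.
apply: (@bounded_dual _ _ _ K) => [a y z|y].
  by rewrite single_linear linearP.
rewrite ler_norml lerNl -linearN -singleN.
by rewrite (le_trans (lK _))/= ?ls ?normrN// (le_trans (lK _)) ?ls.
Qed.

(** The dual of a sup-normed power is the l_1-sum of the duals: vectors almost norming each
    coordinate, with signs making the values nonnegative up to the error, form a single family in
    the unit ball on which [l] is tested. *)
Lemma sum_dual_norm_le1 (l : {linear (J -> X) -> R^o}) :
  (forall j, topological_dual X (fun y => l (single j y))) ->
  (forall v, (forall j, `|v j| <= 1) -> l v <= 1) ->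
  \sum_j dual_norm (fun y => l (single j y) : R^o) <= 1.
Proof.
move=> Dl l1; apply/ler_addgt0Pr => e e0.
(* The successor keeps the error per coordinate meaningful when [J] is empty; the total error is
   still at most [e]. *)
pose n := (#|J|.+1%:R : R); have n0 : 0 < n by rewrite ltr0n.
have /choice [y yP] : forall j, exists y : X, `|y| <= 1 /\
    dual_norm (fun y => l (single j y) : R^o) - e / n <= l (single j y).
  move=> j; have [] := sup_adherent (divr_gt0 e0 n0) (dual_norm_has_sup (Dl j)).
  move=> _ [y /= y1 <-] /ltW h.
  have [l0|l0] := leP 0 (l (single j y)).
    by exists y; split => //; rewrite ger0_norm in h.
  exists (- y); rewrite normrN; split => //.
  by rewrite singleN linearN; rewrite ltr0_norm in h.
have := l1 y (fun j => (yP j).1); rewrite linear_coordinates => h.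
have : \sum_j (dual_norm (fun y => l (single j y) : R^o) - e / n) <= 1.
  by apply: le_trans h; apply: ler_sum => j _; exact: (yP j).2.
have -> : \sum_j (dual_norm (fun y => l (single j y) : R^o) - e / n) =
    \sum_j dual_norm (fun y => l (single j y) : R^o) - e / n * #|J|%:R.
  by rewrite big_split/= sumr_const mulNrn mulr_natr.
suff ne : e / n * #|J|%:R <= e.
  by rewrite lerBlDr => /le_trans; apply; rewrite lerD2l.
by rewrite -mulrA ger_pMr// mulrC ler_pdivrMr// mul1r ler_nat.
Qed.

End Coordinates.

(** Induction on the number of coordinates of modulus different from 1. Such a coordinate [a i]
    exhibits the sum as the convex combination, with weights [(1 + a i) / 2] and [(1 - a i) / 2], of
    the sums where it is replaced by 1 and by -1. *)
Lemma cube_of_signs (R : realType) (X : normedModType R) (I : finType)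
    (e : I -> X) (A : R) :
  (forall s : {ffun I -> bool}, `|\sum_i (-1) ^+ s i *: e i| <= A) ->
  forall a : I -> R, (forall i, `|a i| <= 1) -> `|\sum_i a i *: e i| <= A.
Proof.
move=> sA a; have [n] := ubnP #|[pred i | `|a i| != 1]|.
elim: n a => // n IH a; rewrite ltnS => an a1.
have [i ai|a_ext] := pickP (fun i => `|a i| != 1); last first.
  have := sA [ffun i => a i < 0]; congr (`|_| <= _); apply: eq_bigr => i _.
  rewrite ffunE; congr (_ *: _); have /negbFE/eqP := a_ext i.
  by case: ltrP => [a0|a0]; [rewrite ltr0_norm// => <-; rewrite opprK|rewrite ger0_norm].
pose a_ (c : R) k := if k == i then c else a k.
have IHc c : `|c| = 1 -> `|\sum_k a_ c k *: e k| <= A.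
  move=> c1; apply: IH => [|k]; last by rewrite /a_; case: ifP => // _; rewrite c1.
  apply: leq_trans an; apply: proper_card; apply/properP; split.
    apply/fintype.subsetP => k; rewrite !inE /a_; case: ifP => // _.
    by rewrite c1 eqxx.
  by exists i; rewrite !inE// /a_ eqxx c1 eqxx.
have sumE c : \sum_k a_ c k *: e k = c *: e i + \sum_(k | k != i) a k *: e k.
  rewrite (bigD1 i)//= /a_ eqxx; congr (_ + _); apply: eq_bigr => k ki.
  by rewrite (negbTE ki).
set t := \sum_(k | k != i) a k *: e k in sumE.
have -> : \sum_k a k *: e k = ((1 + a i) / 2) *: (\sum_k a_ 1 k *: e k) +
    ((1 - a i) / 2) *: (\sum_k a_ (-1) k *: e k).
  rewrite !sumE (bigD1 i)//= -/t !scalerDr addrACA !scalerA.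
  rewrite -(scalerDl (e i)) -(scalerDl t).
  have -> : (1 + a i) / 2 * 1 + (1 - a i) / 2 * -1 = a i by field.
  have -> : (1 + a i) / 2 + (1 - a i) / 2 = 1 by field.
  by rewrite scale1r.
have /andP[l u] : -1 <= a i <= 1 by rewrite -ler_norml.
apply: le_trans (ler_normD _ _) _; rewrite !normrZ !ger0_norm; try lra.
have h1 := IHc 1 (normr1 _); have h2 := IHc (-1) (normrN1 _).
have -> : A = (1 + a i) / 2 * A + (1 - a i) / 2 * A by field.
by apply: lerD; apply: ler_wpM2l => //; lra.
Qed.

(** * The gauge of approximable families and its bound by duality *)

Section Gauge.
Variables (R : realType) (X : completeNormedModType R) (J : finType).
Variables (x : J -> X) (K : R).
Hypothesis K0 : 0 < K.

(* [v] is within [B] of the image of [x] under an operator that factors through a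
   finite-dimensional l_infty space with constant [A]; the cube of l_infty is
   tested at its vertices only, so that finitely many seminorms are involved. *)
Definition approximant (v : J -> X) (A B : R) : Prop :=
  0 <= B /\ exists (I : finType) (phi : I -> X -> R^o) (e : I -> X),
    [/\ forall i, topological_dual X (phi i), forall i, dual_norm (phi i) <= 1,
        forall s : {ffun I -> bool}, `|\sum_i (-1) ^+ s i *: e i| <= A &
        forall j, `|v j - \sum_i phi i (x j) *: e i| <= B].

(** [K] is the price of a unit of error. Penalising the error instead of prescribing it makes the
    infimum finite at every [v] and sublinear, as Hahn-Banach requires. *)
Definition gauge (v : J -> X) : R :=
  inf [set r | exists A B, approximant v A B /\ r = A + K * B].

Lemma approximant_ge0 v A B : approximant v A B -> 0 <= A + K * B.
Proof.
move=> [B0 [I [phi [e [_ _ /(_ [ffun=> false]) sA _]]]]].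
by rewrite addr_ge0 ?(le_trans _ sA)// mulr_ge0// ltW.
Qed.

Lemma gauge_le v A B : approximant v A B -> gauge v <= A + K * B.
Proof.
move=> h; apply: ge_inf; last by exists A, B.
by exists 0 => _ [A' [B' [h' ->]]]; exact: approximant_ge0 h'.
Qed.

Lemma approximant_norm v : approximant v 0 (\sum_j `|v j|).
Proof.
split; first exact: sumr_ge0.
exists 'I_0, (fun _ _ => 0), (fun=> 0); split.
- by move=> [].
- by move=> [].
- by move=> s; rewrite big_ord0 normr0.
- move=> j; rewrite big_ord0 subr0 (bigD1 j)//= lerDl.
  exact: sumr_ge0.
Qed.

Lemma le_gauge v b : (forall A B, approximant v A B -> b <= A + K * B) ->
  b <= gauge v.
Proof.
move=> h; apply: lb_le_inf; last by move=> _ [A [B [/h ? ->]]].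
exists (0 + K * \sum_j `|v j|), 0, (\sum_j `|v j|); split => //.
exact: approximant_norm.
Qed.

Lemma gauge_lt v b : gauge v < b ->
  exists A B, approximant v A B /\ A + K * B < b.
Proof.
move=> vb; apply: contrapT => h; move: vb; apply/negP; rewrite -leNgt.
apply: le_gauge => A B hAB; rewrite leNgt; apply/negP => lt.
by apply: h; exists A, B.
Qed.

Lemma approximantZ c v A B : 0 < c -> approximant v A B ->
  approximant (c *: v) (c * A) (c * B).
Proof.
move=> c0 [B0 [I [phi [e [Dphi nphi sA vB]]]]].
split; first by rewrite mulr_ge0// ltW.
exists I, phi, (fun i => c *: e i); split => //.
- move=> s; under eq_bigr do rewrite scalerA mulrC -scalerA.
  by rewrite -scaler_sumr normrZ gtr0_norm// ler_pM2l.
- move=> j; under eq_bigr do rewrite scalerA mulrC -scalerA.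
  by rewrite -scaler_sumr !fctE -scalerBr normrZ gtr0_norm// ler_pM2l.
Qed.

(** The two families are put side by side. A sign vector on the disjoint sum is a pair of sign
    vectors, so the constants add; this is why the dimension of the cube is left free. *)
Lemma approximantD v v' A B A' B' : approximant v A B -> approximant v' A' B' ->
  approximant (v + v') (A + A') (B + B').
Proof.
move=> [B0 [I [phi [e [Dphi nphi sA vB]]]]].
move=> [B0' [I' [phi' [e' [Dphi' nphi' sA' vB']]]]].
split; first exact: addr_ge0.
exists (I + I')%type, (fun k => match k with inl i => phi i | inr i => phi' i end),
  (fun k => match k with inl i => e i | inr i => e' i end).
split; [by case|by case| |].
- move=> s; rewrite big_sumType/=; apply: le_trans (ler_normD _ _) _.
  apply: lerD.
    by have := sA [ffun i => s (inl i)]; congr (`|_| <= _);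
      apply: eq_bigr => i _; rewrite ffunE.
  by have := sA' [ffun i => s (inr i)]; congr (`|_| <= _);
    apply: eq_bigr => i _; rewrite ffunE.
- move=> j; rewrite big_sumType/= !fctE opprD addrACA.
  by apply: le_trans (ler_normD _ _) _; exact: lerD.
Qed.

Lemma gauge_sublinear : sublinear gauge.
Proof.
split=> [c v c0|v v'].
  rewrite -ler_pdivrMl//; apply: le_gauge => A B h; rewrite ler_pdivrMl//.
  by apply: le_trans (gauge_le (approximantZ c0 h)) _; lra.
rewrite -lerBlDr; apply: le_gauge => A B h; rewrite lerBlDr -lerBlDl.
apply: le_gauge => A' B' h'; rewrite lerBlDl.
by apply: le_trans (gauge_le (approximantD h h')) _; lra.
Qed.

End Gauge.

Section GaugeBound.
Variables (R : realType) (X : completeNormedModType R) (J : finType).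
Variables (x : J -> X) (K : R).
Hypothesis K0 : 0 < K.
Hypothesis hX : L1_predual X.

Lemma gauge_supporting_functional : exists l : {linear (J -> X) -> R^o},
  (forall v, l v <= gauge x K v) /\ l x = gauge x K x.
Proof.
have sg := gauge_sublinear x K0; pose g := gauge x K x.
have lA : linear (fun a : R^o => a *: x : J -> X).
  by move=> a b c; rewrite scalerDl -scalerA.
have leta : linear (fun a : R^o => a * g : R^o).
  by move=> a b c; rewrite mulrDl -mulrA.
have [|l [lg lA']] := @hahn_banach_extension R (J -> X) R^o (pack_linear lA)
    (pack_linear leta) _ sg.
  move=> a /=; have [a0|a0|->] := ltgtP a 0.
  - have := sublinearN (a *: x) sg; apply: le_trans; rewrite lerNr.
    rewrite -scaleNr -mulNr; apply: sg.1.
    by rewrite oppr_gt0.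
  - rewrite -ler_pdivlMl//; have := sg.1 a^-1 (a *: x).
    by rewrite scalerA mulVf ?gt_eqF// scale1r invr_gt0; exact.
  - by rewrite scale0r mul0r (sublinear0 sg).
exists l; split => //.
by have := lA' 1; rewrite /= scale1r mul1r.
Qed.

(* Hahn-Banach extension of [e |-> \sum_i g i (e i)], seen as a functional of
   [s |-> \sum_i (-1) ^+ s i *: e i], to all [X]-valued functions of the signs. *)
Lemma sign_decomposition (I : finType) (g : I -> X -> R^o) :
  (forall i, topological_dual X (g i)) ->
  (forall e : I -> X, (forall s : {ffun I -> bool},
      `|\sum_i (-1) ^+ s i *: e i| <= 1) -> \sum_i g i (e i) <= 1) ->
  exists theta : {ffun I -> bool} -> X -> R^o,
    [/\ forall s, topological_dual X (theta s),
        \sum_s dual_norm (theta s) <= 1 &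
        forall i, g i = \sum_(s : {ffun I -> bool}) (-1) ^+ s i *: theta s].
Proof.
move=> Dg g1; pose W := {ffun I -> bool} -> X.
pose q (w : W) : R := \big[Num.max/0]_s `|w s|.
have qge w s : `|w s| <= q w by exact: (le_bigmax _ (fun s => `|w s|)).
have qle w b : 0 <= b -> (forall s, `|w s| <= b) -> q w <= b.
  by move=> b0 wb; apply: bigmax_le => // s _; exact: wb.
have q0 w : 0 <= q w by exact: bigmax_ge_id.
have sq : sublinear q.
  split=> [a w a0|w w'].
    apply: qle; first by rewrite mulr_ge0// ltW.
    by move=> s; rewrite !fctE normrZ gtr0_norm// ler_pM2l.
  apply: qle; first exact: addr_ge0.
  by move=> s; rewrite !fctE (le_trans (ler_normD _ _))// lerD.
have lS : linear (fun (e : I -> X) (s : {ffun I -> bool}) => \sum_i (-1) ^+ s i *: e i).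
  move=> a e e'; apply/funext => s; rewrite !fctE scaler_sumr -big_split/=.
  by apply: eq_bigr => i _; rewrite scalerDr !scalerA mulrC.
have leta : linear (fun e : I -> X => \sum_i g i (e i) : R^o).
  move=> a e e'; rewrite scaler_sumr -big_split/=; apply: eq_bigr => i _.
  by have [lg _] := Dg i; rewrite !fctE lg.
have [|l [lq lS']] := @hahn_banach_extension R W (I -> X) (pack_linear lS)
    (pack_linear leta) _ sq.
  move=> e /=; apply/ler_addgt0Pr => d d0.
  (* A radius slightly above the sup norm allows rescaling even when that norm is 0. *)
  pose c := q (pack_linear lS e) + d.
  have c0 : 0 < c by rewrite ltr_wpDl.
  have := g1 (c^-1 *: e).
  have -> : \sum_i g i ((c^-1 *: e) i) = c^-1 * \sum_i g i (e i).
    exact: linear_funZ _ _ leta.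
  rewrite ler_pdivrMl// mulr1; apply => s.
  have -> : \sum_i (-1) ^+ s i *: (c^-1 *: e) i = c^-1 *: pack_linear lS e s.
    by rewrite /= scaler_sumr; apply: eq_bigr => i _; rewrite !scalerA mulrC.
  rewrite normrZ gtr0_norm ?invr_gt0// ler_pdivrMl// mulr1.
  by rewrite (le_trans (qge _ s))// lerDl ltW.
pose theta s : X -> R^o := fun y => l (single s y).
have Dtheta s : topological_dual X (theta s).
  apply: (@coordinate_dual _ _ _ l 1) => w; rewrite mul1r.
  apply: le_trans (lq w) _; apply: qle; first exact: sumr_ge0.
  by move=> t; rewrite (bigD1 t)//= lerDl sumr_ge0.
exists theta; split => //.
  apply: sum_dual_norm_le1 => // w w1; apply: le_trans (lq w) _.
  exact: qle.
move=> i; apply/funext => y; rewrite fct_sumE.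
have := lS' (single i y); rewrite /= linear_coordinates => h.
transitivity (\sum_k g k (single i y k)).
  rewrite (bigD1 i)//= /single eqxx big1 ?addr0// => k ki.
  rewrite (negbTE ki); have [lg _] := Dg k.
  by rewrite -(scale0r 0) (linear_funZ _ _ lg) mul0r.
rewrite -h; apply: eq_bigr => s _.
rewrite (bigD1 i)//= [single i y i]/single eqxx big1 ?addr0 => [|k ki]; last first.
  by rewrite /single (negbTE ki) scaler0.
by have [lt _] := Dtheta s; rewrite -[LHS]/(theta s _) (linear_funZ _ _ lt).
Qed.

(* The gauge at [x] is attained by a functional [(psi j)_j]. The pairing
   [\sum_i mean i (g i)], in which [mean i] stands for an element of the bidual,
   is bounded through the sign decomposition of [g], so that [mean i] need not be
   moved into [X] by local reflexivity. *)
Lemma gauge_le1 : gauge x K x <= 1.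
Proof.
have [l [lg lx]] := gauge_supporting_functional.
pose psi j : X -> R^o := fun y => l (single j y).
have Dpsi j : topological_dual X (psi j).
  apply: (@coordinate_dual _ _ _ l K) => v; apply: le_trans (lg v) _.
  by rewrite -[leRHS]add0r; exact: gauge_le (approximant_norm x v).
apply/ler_addgt0Pr => d d0; pose N := \sum_j `|x j|.
(* With tolerance [d / (1 + N)] on each functional, the total error at [x] is
   [d * N / (1 + N) <= d], also when [N = 0]. *)
have N1 : 0 < 1 + N by rewrite ltr_wpDr// sumr_ge0.
have [I [phi [mean [Dphi nphi mlin mnorm approx]]]] :=
  finite_rank_approximation hX Dpsi (divr_gt0 d0 N1).
pose g i := \sum_j phi i (x j) *: psi j.
have Dg i : topological_dual X (g i) by exact: dual_sum.
have lgE (e : I -> X) : \sum_i g i (e i) = l (fun j => \sum_i phi i (x j) *: e i).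
  rewrite linear_coordinates.
  transitivity (\sum_i \sum_j phi i (x j) * psi j (e i)).
    by apply: eq_bigr => i _; rewrite /g fct_sumE.
  rewrite exchange_big; apply: eq_bigr => j _; have [lpsi _] := Dpsi j.
  rewrite -[RHS]/(pack_linear lpsi _) linear_sum/=.
  by apply: eq_bigr => i _; rewrite (linear_funZ _ _ lpsi).
have [|theta [Dtheta ntheta gE]] := sign_decomposition Dg.
  move=> e es; rewrite lgE; apply: le_trans (lg _) _.
  (* The operator image of [x] is approximated by itself without error, so its gauge, and with it
     the value of [l], is at most 1. *)
  have : approximant x (fun j => \sum_i phi i (x j) *: e i) 1 0.
    split => //; exists I, phi, e; split => // j.
    by rewrite subrr normr0.
  by move=> /(gauge_le K0); rewrite mulr0 addr0.
have mean_g : \sum_i mean i (g i) <= 1.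
  apply: le_trans ntheta; apply: le_trans (_ : \sum_s \sum_i `|mean i (theta s)| <= _).
    rewrite exchange_big; apply: ler_sum => i _; rewrite gE.
    rewrite (dual_functional_sum _ _ (mlin i))//; apply: ler_sum => s _.
    by rewrite (le_trans (ler_norm _))// normrM normrX normrN1 expr1n mul1r.
  by apply: ler_sum => s _; exact: mnorm.
rewrite -lx linear_coordinates.
apply: le_trans (_ : \sum_j (\sum_i mean i (psi j) * phi i (x j) +
    d / (1 + N) * `|x j|) <= _).
  apply: ler_sum => j _; rewrite addrC -lerBlDr.
  exact: le_trans (ler_norm _) (approx j (x j)).
rewrite big_split/= -mulr_sumr exchange_big/=; apply: lerD.
  apply: le_trans mean_g; rewrite le_eqVlt; apply/orP; left; apply/eqP.
  apply: eq_bigr => i _; rewrite (dual_functional_sum _ _ (mlin i))//.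
  by apply: eq_bigr => j _; rewrite mulrC.
by rewrite -/N -mulrA ger_pMr// mulrC ler_pdivrMr// mul1r lerDr.
Qed.

End GaugeBound.

Theorem cube_factorization (R : realType) (X : completeNormedModType R)
    (J : finType) (x : J -> X) (eps : R) :
  L1_predual X -> 0 < eps -> eps <= 1 ->
  exists (I : finType) (phi : I -> X -> R^o) (e : I -> X),
    [/\ forall i, topological_dual X (phi i), forall i, dual_norm (phi i) <= 1,
        forall a : I -> R, (forall i, `|a i| <= 1) ->
          `|\sum_i a i *: e i| <= 1 + eps &
        forall j, `|x j - \sum_i phi i (x j) *: e i| <= eps].
Proof.
(* As [eps <= 1], the gauge at [x] is below 2, so the price [2 / eps] forces an error of at most
   [eps]. *)
move=> hX eps0 eps1; have K0 : 0 < 2 / eps by rewrite divr_gt0.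
have glt : gauge x (2 / eps) x < 1 + eps.
  by rewrite (le_lt_trans (gauge_le1 x K0 hX))// ltrDl.
have [A [B [[B0 [I [phi [e [Dphi nphi sA xB]]]]] AB]]] := gauge_lt glt.
have A0 : 0 <= A by exact: le_trans (sA [ffun=> false]).
have KB : 0 <= 2 / eps * B by rewrite mulr_ge0// ltW.
exists I, phi, e; split => // [a a1|j].
  by apply: le_trans (cube_of_signs sA a1) _; lra.
apply: le_trans (xB j) _; have : 2 / eps * B <= 2 by lra.
by rewrite -mulrA ger_pMr// mulrC ler_pdivrMr// mul1r.
Qed.

(** * Total boundedness and precompactness *)

Section TotallyBounded.
Variables (R : realType) (X : normedModType R).
Implicit Types S : set X.

(** The points of the net may lie outside [S], so that a net of a set also serves its subsets. *)
Definition totally_bounded S : Prop := forall eps : R, 0 < eps ->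
  exists s : seq X, forall v, S v -> exists2 u, u \in s & `|v - u| <= eps.

Lemma precompact_totally_bounded S : precompact S -> totally_bounded S.
Proof.
rewrite precompactE compact_cover => cS eps e0.
have [|v Sv|D _ SD] := cS X setT (fun u => ball u eps).
- by move=> u _; exact: ball_open.
- by exists v => //; exact: ballxx.
- exists (finmap.enum_fset D) => v /subset_closure /SD [u /= uD].
  rewrite -ball_normE /= => vu; exists u => //.
  by rewrite distrC ltW.
Qed.

Lemma sub_totally_bounded S S' : S `<=` S' -> totally_bounded S' ->
  totally_bounded S.
Proof.
by move=> SS' tS' eps /tS' [s sP]; exists s => v /SS' /sP.
Qed.

Lemma approx_totally_bounded S :
  (forall eps : R, 0 < eps -> exists2 S', totally_bounded S' &
    forall v, S v -> exists2 u, S' u & `|v - u| <= eps) ->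
  totally_bounded S.
Proof.
move=> h eps e0; have e2 : 0 < eps / 2 by rewrite divr_gt0.
have [S' /(_ _ e2) [s sP] SS'] := h _ e2.
exists s => v /SS' [u /sP [w ws uw] vu]; exists w => //.
rewrite -(subrK u v) -addrA (splitr eps).
by apply: le_trans (ler_normD _ _) _; exact: lerD.
Qed.

Lemma totally_boundedD S S' : totally_bounded S -> totally_bounded S' ->
  totally_bounded [set w | exists u v, [/\ S u, S' v & w = u + v]].
Proof.
move=> tS tS' eps e0; have e2 : 0 < eps / 2 by rewrite divr_gt0.
have [s sP] := tS _ e2; have [s' sP'] := tS' _ e2.
exists [seq a + b | a <- s, b <- s'] => _ [u [v [/sP [a sa ua] /sP' [b sb vb] ->]]].
exists (a + b); first exact: allpairs_f.
rewrite opprD addrACA (splitr eps).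
by apply: le_trans (ler_normD _ _) _; exact: lerD.
Qed.

Lemma totally_boundedN S : totally_bounded S ->
  totally_bounded [set - u | u in S].
Proof.
move=> tS eps /tS [s sP]; exists [seq - u | u <- s] => _ [v /sP [u us vu] <-].
by exists (- u); [exact: map_f|rewrite -opprD normrN].
Qed.

End TotallyBounded.

(** An ultrafilter containing a finite union of balls contains one of them. One on the closure of
    [S] thus contains arbitrarily small balls, is Cauchy and converges by completeness. *)
Lemma totally_bounded_precompact (R : realType) (X : completeNormedModType R)
    (S : set X) : totally_bounded S -> precompact S.
Proof.
move=> tS; rewrite precompactE compact_ultra => F FU FS.
have Fcover (s : seq X) (r : R) : F [set v | exists2 u, u \in s & `|v - u| <= r] ->
    exists u, F [set v | `|v - u| <= r].
  elim: s => [|a s IH] h.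
    by have [v [u]] := filter_ex h.
  have [?|na] := in_ultra_setVsetC [set v | `|v - a| <= r] FU; first by exists a.
  apply: IH; apply: filterS2 h na => v [u + vu] va.
  rewrite inE => /predU1P [ua|us]; last by exists u.
  by exfalso; apply: va; rewrite /= -ua.
have Fcauchy : cauchy F.
  apply: cauchy_exP => eps e0.
  have e4 : 0 < eps / 4 by rewrite divr_gt0.
  have [s sP] := tS _ e4.
  (* A point of the closure is within [eps / 4] of [S], whose points are within [eps / 4] of the
     net. *)
  have [u Fu] : exists u, F [set v | `|v - u| <= eps / 2].
    apply: (Fcover s); apply: filterS FS => v clv.
    have [w [Sw]] := clv _ (nbhsx_ballx v _ e4).
    rewrite -ball_normE /= => vw; have [u us wu] := sP _ Sw.
    exists u => //; rewrite -(subrK w v) -addrA.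
    apply: le_trans (ler_normD _ _) _; move: vw wu; lra.
  exists u; apply: filterS Fu => v /= vu; rewrite -ball_normE /= distrC.
  by apply: le_lt_trans vu _; lra.
have Fcvg : cvg F by exact: cauchy_cvg.
exists (lim F); split => //.
suff : closure (closure S) (lim F).
  by rewrite -(closure_id (closure S)).1//; exact: closed_closure.
move=> B FB; have : F (closure S `&` B) by apply: filterI => //; exact: Fcvg.
exact: filter_ex.
Qed.

(** Rounding each coefficient to a finite net of [[- L, L]] leaves finitely many sums. This is how
    finite rank yields compact slopes. *)
Lemma cube_image_totally_bounded (R : realType) (X : normedModType R)
    (I : finType) (e : I -> X) (L : R) :
  totally_bounded [set v | exists2 a : I -> R, (forall i, `|a i| <= L) &
    v = \sum_i a i *: e i].
Proof.
move=> eps e0; pose E := \sum_i `|e i|.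
have E1 : 0 < 1 + E by rewrite ltr_wpDr// sumr_ge0.
have [r rP] : exists r : seq R, forall b : R, `|b| <= L ->
    exists2 u, u \in r & `|b - u| <= eps / (1 + E).
  have /precompact_totally_bounded tb : precompact (`[- L, L]%classic : set R^o).
    by rewrite precompact_closed; [exact: segment_compact|exact: interval_closed].
  have [r rP] := tb _ (divr_gt0 e0 E1); exists r => b bL.
  by apply: rP; rewrite /= in_itv/= -ler_norml.
exists [seq \sum_i ssval (c i) *: e i | c : {ffun I -> seq_sub r}] => _ [a aL ->].
have /choice [u uP] i : exists u : seq_sub r, `|a i - ssval u| <= eps / (1 + E).
  by have [u ur au] := rP _ (aL i); exists (SeqSub ur).
exists (\sum_i ssval ([ffun i => u i] i) *: e i).
  by apply/fintype.imageP; exists [ffun i => u i].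
rewrite -sumrB; apply: le_trans (ler_norm_sum _ _ _) _.
apply: le_trans (_ : \sum_i eps / (1 + E) * `|e i| <= _).
  by apply: ler_sum => i _; rewrite ffunE -scalerBl normrZ ler_wpM2r.
by rewrite -mulr_sumr -/E -mulrA ger_pMr// mulrC ler_pdivrMr// mul1r lerDr.
Qed.

(** * Lipschitz constants, slopes and scalar extension *)

Definition lipschitz_with (R : realType) (M : metricType R) (X : normedModType R)
    (A : set M) (c : R) (f : M -> X) : Prop :=
  forall x y, A x -> A y -> `|f x - f y| <= c * mdist x y.

Section LipschitzNorm.
Variables (R : realType) (M : metricType R) (X : normedModType R).
Implicit Types (A : set M) (f g : M -> X).

Lemma slope_norm_le A f c x y : lipschitz_with A c f -> A x -> A y -> x <> y ->
  `|(mdist x y)^-1 *: (f x - f y)| <= c.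
Proof.
move=> fc Ax Ay xy; have d0 : 0 < mdist x y by rewrite mdist_gt0; apply/eqP.
by rewrite normrZ gtr0_norm ?invr_gt0// ler_pdivrMl// mulrC fc.
Qed.

Lemma lipschitz_with_norm A f : is_lipschitz A f ->
  lipschitz_with A (lipschitz_norm A f) f.
Proof.
move=> [k fk] x y Ax Ay; have [->|/eqP xy] := eqVneq x y.
  by rewrite subrr normr0 mdistxx mulr0.
have d0 : 0 < mdist x y by rewrite mdist_gt0; apply/eqP.
rewrite -ler_pdivrMr//.
have -> : `|f x - f y| / mdist x y = `|(mdist x y)^-1 *: (f x - f y)|.
  by rewrite normrZ gtr0_norm ?invr_gt0// mulrC.
apply: ub_le_sup; last by exists ((mdist x y)^-1 *: (f x - f y)) => //; exists x, y.
exists k => _ [_ [a [b [Aa Ab ab ->]]] <-].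
exact: slope_norm_le fk Aa Ab ab.
Qed.

(** The bound [0 <= c] covers the case of no slopes, where the supremum is 0. *)
Lemma lipschitz_norm_le A f c : 0 <= c -> lipschitz_with A c f ->
  lipschitz_norm A f <= c.
Proof.
move=> c0 fc; rewrite /lipschitz_norm; set E := [set _ | _ in _].
have [->|/set0P E0] := eqVneq E set0; first by rewrite sup0.
apply: ge_sup => // _ [_ [a [b [Aa Ab ab ->]]] <-].
exact: slope_norm_le fc Aa Ab ab.
Qed.

Lemma lipschitz_norm_ge0 A f : is_lipschitz A f -> 0 <= lipschitz_norm A f.
Proof.
move=> [k fk]; rewrite /lipschitz_norm; set E := [set _ | _ in _].
have [->|/set0P [r Er]] := eqVneq E set0; first by rewrite sup0.
apply: le_trans (_ : r <= _); first by case: Er => v _ <-.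
apply: ub_le_sup => //; exists k => _ [_ [a [b [Aa Ab ab ->]]] <-].
exact: slope_norm_le fk Aa Ab ab.
Qed.

Lemma slopes_totally_boundedD A f g : totally_bounded (slopes A f) ->
  totally_bounded (slopes A g) -> totally_bounded (slopes A (f + g)).
Proof.
move=> tf tg; apply: sub_totally_bounded (totally_boundedD tf tg).
move=> _ [x [y [Ax Ay xy ->]]].
exists ((mdist x y)^-1 *: (f x - f y)), ((mdist x y)^-1 *: (g x - g y)).
split; [by exists x, y|by exists x, y|].
by rewrite -scalerDr !fctE opprD addrACA.
Qed.

Lemma slopes_totally_boundedB A f g : totally_bounded (slopes A f) ->
  totally_bounded (slopes A g) -> totally_bounded (slopes A (f - g)).
Proof.
move=> tf tg; apply: slopes_totally_boundedD => //.
apply: sub_totally_bounded (totally_boundedN tg) => _ [x [y [Ax Ay xy ->]]].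
exists ((mdist x y)^-1 *: (g x - g y)); first by exists x, y.
by rewrite -scalerN !fctE opprB opprK addrC.
Qed.

Lemma sub_slopes A B f : A `<=` B -> slopes A f `<=` slopes B f.
Proof.
move=> AB _ [x [y [Ax Ay xy ->]]].
by exists x, y; split => //; exact: AB.
Qed.

Lemma lipschitz_withD A c c' f g : lipschitz_with A c f ->
  lipschitz_with A c' g -> lipschitz_with A (c + c') (f + g).
Proof.
move=> fc gc x y Ax Ay; rewrite !fctE opprD addrACA mulrDl.
by apply: le_trans (ler_normD _ _) _; apply: lerD; [exact: fc|exact: gc].
Qed.

End LipschitzNorm.

Lemma mcshane_extension (R : realType) (M : metricType R) (A : set M)
    (u : M -> R) (c : R) : A !=set0 -> 0 <= c ->
  (forall x y, A x -> A y -> `|u x - u y| <= c * mdist x y) ->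
  exists g : M -> R, (forall x, A x -> g x = u x) /\
    forall x y, `|g x - g y| <= c * mdist x y.
Proof.
move=> [a Aa] c0 uc.
pose E x := [set u z + c * mdist x z | z in A].
have tri (x y z : M) : c * mdist x z <= c * mdist x y + c * mdist y z.
  by rewrite -mulrDr ler_wpM2l// metric_triangle.
have hE x : has_inf (E x).
  split; first by exists (u a + c * mdist x a); exists a.
  exists (u a - c * mdist x a) => _ [z Az <-].
  have := uc _ _ Aa Az; rewrite ler_norml => /andP[_ h].
  by have := tri a x z; rewrite (metric_sym a x); lra.
have gle x z : A z -> inf (E x) <= u z + c * mdist x z.
  by move=> Az; apply: ge_inf; [exact: (hE x).2|exists z].
have leg x b : (forall z, A z -> b <= u z + c * mdist x z) -> b <= inf (E x).
  by move=> h; apply: lb_le_inf; [exact: (hE x).1|move=> _ [z Az <-]; exact: h].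
exists (fun x => inf (E x)); split => [x Ax|x y].
  apply/eqP; rewrite eq_le; apply/andP; split.
    by have := gle x x Ax; rewrite mdistxx mulr0 addr0.
  apply: leg => z Az; have := uc _ _ Ax Az; rewrite ler_norml => /andP[_ h].
  lra.
have half (v w : M) : inf (E v) - inf (E w) <= c * mdist v w.
  rewrite lerBlDr -lerBlDl; apply: leg => z Az.
  by have := gle v z Az; have := tri v w z; lra.
by rewrite ler_norml half andbT lerNl opprB (metric_sym x y) half.
Qed.

(** * Extending up to a small Lipschitz error *)

Section OneStep.
Variables (R : realType) (X : completeNormedModType R) (M : metricType R).
Variables (hX : L1_predual X) (N : set M) (x0 : M).
Hypothesis Nx0 : N x0.

(** Let Q be the identity minus the operator [\sum_i phi i (.) *: e i]. On [N], [f - G] is Q after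
    [f], so its slopes are Q of slopes of [f], and Q is small on a finite net of these. Vanishing at
    [x0] is passed on to [G] for the later convergence argument. *)
Lemma approximate_extension (f : M -> X) (c eta delta : R) :
  0 <= c -> 0 < eta -> 0 < delta -> f x0 = 0 ->
  lipschitz_with N c f -> totally_bounded (slopes N f) ->
  exists G : M -> X, [/\ totally_bounded (slopes setT G), G x0 = 0,
    lipschitz_with setT ((1 + eta) * c) G & lipschitz_with N delta (f - G)].
Proof.
move=> c0 eta0 delta0 fx0 fc tf.
(* If [u] is a net point near a slope [v], then [Q v] consists of [v - u], [Q u] and the operator at
   [v - u], of norms at most [eps], [eps] and [(1 + eps) * eps]. For [eps <= 1] the total is at most
   [4 * eps], whence [delta / 4]. *)
pose eps := Num.min 1 (Num.min eta (delta / 4)).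
have eps0 : 0 < eps by rewrite !lt_min ltr01 eta0 divr_gt0.
have eps1 : eps <= 1 by rewrite ge_min lexx.
have epse : eps <= eta by rewrite !ge_min lexx orbT.
have epsd : 4 * eps <= delta by rewrite mulrC -ler_pdivlMr// !ge_min lexx !orbT.
have [s sP] := tf _ eps0.
have [I [phi [e [Dphi nphi cube approx]]]] :=
  cube_factorization (fun j : 'I_(size s) => nth 0 s j) hX eps0 eps1.
have scaled_cube (a : I -> R) t : 0 <= t -> (forall i, `|a i| <= t) ->
    `|\sum_i a i *: e i| <= (1 + eps) * t.
  move=> t0 at_; have [t00|tn0] := eqVneq t 0.
    rewrite t00 mulr0 big1 ?normr0// => i _.
    have := at_ i; rewrite t00 normr_le0 => /eqP ->.
    by rewrite scale0r.
  have tp : 0 < t by rewrite lt_neqAle eq_sym tn0.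
  have -> : \sum_i a i *: e i = t *: \sum_i (a i / t) *: e i.
    rewrite scaler_sumr; apply: eq_bigr => i _.
    by rewrite scalerA mulrCA mulfV// mulr1.
  rewrite normrZ gtr0_norm// mulrC ler_pM2r//; apply: cube => i.
  by rewrite normrM normfV (gtr0_norm tp) ler_pdivrMr// mul1r.
have phi_le i v : `|phi i v| <= `|v|.
  apply: le_trans (dual_normP v (Dphi i)) _.
  by rewrite -[leRHS]mul1r ler_wpM2r.
have phiB i v w : phi i (v - w) = phi i v - phi i w.
  by have [l _] := Dphi i; exact: (linearB (pack_linear l)).
have phiZ i a v : phi i (a *: v) = a * phi i v.
  by have [l _] := Dphi i; exact: linear_funZ.
have /choice [g gP] i : exists g : M -> R, (forall x, N x -> g x = phi i (f x)) /\
    forall x y, `|g x - g y| <= c * mdist x y.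
  apply: mcshane_extension => //; first by exists x0.
  by move=> x y Nx Ny; rewrite -phiB (le_trans (phi_le _ _))// fc.
pose G x := \sum_i g i x *: e i.
have GB x y : G x - G y = \sum_i (g i x - g i y) *: e i.
  by rewrite /G -sumrB; apply: eq_bigr => i _; rewrite scalerBl.
have Gf x : N x -> G x = \sum_i phi i (f x) *: e i.
  by move=> Nx; apply: eq_bigr => i _; rewrite (gP i).1.
exists G; split.
- apply: sub_totally_bounded (cube_image_totally_bounded e c).
  move=> _ [x [y [_ _ xy ->]]].
  exists (fun i => (mdist x y)^-1 * (g i x - g i y)).
    move=> i; have d0 : 0 < mdist x y by rewrite mdist_gt0; apply/eqP.
    by rewrite normrM gtr0_norm ?invr_gt0// ler_pdivrMl// mulrC (gP i).2.
  by rewrite GB scaler_sumr; apply: eq_bigr => i _; rewrite scalerA.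
- rewrite Gf// big1// => i _.
  by have := phiZ i 0 0; rewrite scale0r mul0r fx0 => ->; rewrite scale0r.
- move=> x y _ _; rewrite GB -mulrA.
  apply: le_trans (scaled_cube _ (c * mdist x y) _ (fun i => (gP i).2 x y)) _.
    by rewrite mulr_ge0// mdist_ge0.
  by rewrite ler_wpM2r ?lerD2l// mulr_ge0// mdist_ge0.
move=> x y Nx Ny; have [->|/eqP xy] := eqVneq x y.
  by rewrite subrr normr0 mdistxx mulr0.
have d0 : 0 < mdist x y by rewrite mdist_gt0; apply/eqP.
pose v := (mdist x y)^-1 *: (f x - f y).
have vE : f x - f y = mdist x y *: v by rewrite scalerA mulfV ?gt_eqF// scale1r.
pose Q w := w - \sum_i phi i w *: e i.
have -> : (f - G) x - (f - G) y = mdist x y *: Q v.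
  rewrite !fctE opprD addrACA vE -opprD GB /Q scalerBr; congr (_ - _).
  rewrite scaler_sumr; apply: eq_bigr => i _.
  rewrite !(gP i).1//.
  by rewrite scalerA -phiZ -vE phiB.
rewrite normrZ gtr0_norm// mulrC ler_pM2r//; apply: le_trans epsd.
have [u us vu] : exists2 u, u \in s & `|v - u| <= eps by apply: sP; exists x, y.
have Qu : `|Q u| <= eps.
  have ui : (index u s < size s)%N by rewrite index_mem.
  by have := approx (Ordinal ui); rewrite /= nth_index.
have -> : Q v = (v - u) + Q u - \sum_i phi i (v - u) *: e i.
  have -> : \sum_i phi i (v - u) *: e i =
      \sum_i phi i v *: e i - \sum_i phi i u *: e i.
    by rewrite -sumrB; apply: eq_bigr => i _; rewrite phiB scalerBl.
  by rewrite /Q addrA subrK opprB addrA subrK.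
apply: le_trans (ler_normB _ _) _.
have h1 := ler_normD (v - u) (Q u).
have h2 : `|\sum_i phi i (v - u) *: e i| <= (1 + eps) * eps.
  by apply: scaled_cube => [|i]; [exact: ltW|exact: le_trans (phi_le _ _) vu].
have h3 : eps * eps <= eps by rewrite ger_pMl.
lra.
Qed.

End OneStep.

(** * Summing the geometric series of corrections *)

Lemma geometric_small (R : realType) (K eps : R) : 0 <= K -> 0 < eps ->
  exists n, K / 2 ^+ n <= eps.
Proof.
move=> K0 eps0; exists (Num.truncn (K / eps)).+1.
set n := (Num.truncn _).+1; have n2 : (0 : R) < 2 ^+ n by rewrite exprn_gt0.
rewrite ler_pdivrMr// mulrC -ler_pdivrMr//.
apply: le_trans (ltW (truncnS_gt _)) _.
by rewrite -natrX ler_nat ltnW// ltn_expl.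
Qed.

Section Series.
Variables (R : realType) (X : completeNormedModType R) (M : metricType R).
Variables (N : set M) (x0 : M) (f : M -> X) (C : R) (S : nat -> M -> X).
Hypothesis C0 : 0 <= C.
Hypothesis Nx0 : N x0.
Hypothesis fx0 : f x0 = 0.
Hypothesis Sx0 : forall n, S n x0 = 0.
Hypothesis tS : forall n, totally_bounded (slopes setT (S n)).
Hypothesis fS : forall n, lipschitz_with N (C / 2 ^+ n) (f - S n).
Hypothesis SS : forall n, lipschitz_with setT (2 * (C / 2 ^+ n)) (S n.+1 - S n).

(** The increment constant [2 * (C / 2 ^+ n)] is exactly the drop of [4 * (C / 2 ^+ n)] from [n] to
    [n.+1]; keeping the subtracted term makes the induction telescope. *)
Lemma series_tail n k :
  lipschitz_with setT (4 * (C / 2 ^+ n) - 4 * (C / 2 ^+ (n + k))) (S (n + k) - S n).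
Proof.
elim: k => [|k IH]; first by rewrite addn0 !subrr => x y _ _; rewrite subrr normr0 mul0r.
have -> : S (n + k.+1) - S n = (S (n + k).+1 - S (n + k)) + (S (n + k) - S n).
  by rewrite addrA subrK addnS.
have -> : 4 * (C / 2 ^+ n) - 4 * (C / 2 ^+ (n + k.+1)) =
    2 * (C / 2 ^+ (n + k)) + (4 * (C / 2 ^+ n) - 4 * (C / 2 ^+ (n + k))).
  by rewrite addnS exprS; field; rewrite !expf_neq0// pnatr_eq0.
exact: lipschitz_withD.
Qed.

Lemma series_tail_le n k : lipschitz_with setT (4 * (C / 2 ^+ n)) (S (n + k) - S n).
Proof.
move=> x y _ _; apply: le_trans (@series_tail n k x y I I) _.
by rewrite ler_wpM2r ?mdist_ge0// gerBl mulr_ge0// divr_ge0// exprn_ge0.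
Qed.

Lemma lipschitz_with_base (T : M -> X) (A : set M) c x : lipschitz_with A c T ->
  A x -> A x0 -> T x0 = 0 -> `|T x| <= c * mdist x x0.
Proof. by move=> Tc Ax Ax0 T0; have := Tc _ _ Ax Ax0; rewrite T0 subr0. Qed.

(** Since all [S n] vanish at [x0], small Lipschitz constants become pointwise bounds. *)
Lemma series_base n k x : `|S (n + k) x - S n x| <= 4 * (C / 2 ^+ n) * mdist x x0.
Proof.
have := @lipschitz_with_base _ _ _ x (@series_tail_le n k) I I.
by rewrite !fctE !Sx0 subrr => /(_ erefl).
Qed.

Lemma series_cvg : exists F : M -> X, forall n x,
  `|F x - S n x| <= 4 * (C / 2 ^+ n) * mdist x x0.
Proof.
suff /choice [F FP] : forall x, exists l : X, forall n,
    `|l - S n x| <= 4 * (C / 2 ^+ n) * mdist x x0 by exists F => n x.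
move=> x; have cS : cvg (S n x @[n --> \oo]).
  apply: cauchy_cvg; apply: cauchy_exP => eps e0.
  have e2 : 0 < eps / 2 by rewrite divr_gt0.
  have K0 : 0 <= 4 * C * mdist x x0 by rewrite !mulr_ge0// mdist_ge0.
  have [n nP] := geometric_small K0 e2.
  exists (S n x); exists n => // m /= nm; rewrite -ball_normE /= distrC.
  apply: le_lt_trans (_ : eps / 2 < _); last by lra.
  apply: le_trans nP; rewrite -(subnKC nm).
  by apply: le_trans (series_base n (m - n) x) _; rewrite !mulrA mulrAC.
exists (lim (S n x @[n --> \oo])) => n.
apply/ler_addgt0Pr => eps e0.
have [m _ mP] : \forall m \near \oo, `|lim (S n x @[n --> \oo]) - S m x| < eps.
  by move/cvgrPdist_lt : cS; exact.
have := mP (n + m)%N (leq_addl _ _); rewrite /= => h.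
set l := lim _ in h *.
have -> : l - S n x = (S (n + m) x - S n x) + (l - S (n + m) x).
  by rewrite [RHS]addrC addrA subrK.
apply: le_trans (ler_normD _ _) _.
by apply: lerD; [exact: series_base|exact: ltW].
Qed.

Lemma series_extension : exists F : M -> X,
  [/\ totally_bounded (slopes setT F), lipschitz_with setT (4 * C) (F - S 0)
    & forall x, N x -> F x = f x].
Proof.
have [F FS] := series_cvg.
(* The constant of the tails passes to the limit: for two fixed points, [S (n + k)] replaces [F] up
   to [eps] once [k] is large. *)
have Flip n : lipschitz_with setT (4 * (C / 2 ^+ n)) (F - S n).
  move=> x y _ _; apply/ler_addgt0Pr => eps e0.
  have K0 : 0 <= 4 * C * (mdist x x0 + mdist y x0).
    by rewrite !mulr_ge0// addr_ge0// mdist_ge0.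
  have [k kP] := geometric_small K0 e0.
  have small z : `|F z - S (n + k) z| <= 4 * (C / 2 ^+ k) * mdist z x0.
    apply: le_trans (FS (n + k)%N z) _; rewrite ler_wpM2r ?mdist_ge0// ler_pM2l//.
    rewrite ler_wpM2l// lef_pV2 ?posrE ?exprn_gt0//.
    by rewrite ler_weXn2l ?ler1n// leq_addl.
  have -> : (F - S n) x - (F - S n) y = ((S (n + k) - S n) x - (S (n + k) - S n) y) +
      ((F x - S (n + k) x) - (F y - S (n + k) y)).
    have tel (a m p : X) : (m - p) + (a - m) = a - p by rewrite addrC addrA subrK.
    by rewrite !fctE [RHS]addrACA tel -opprD tel.
  apply: le_trans (ler_normD _ _) _; apply: lerD; first exact: series_tail_le.
  apply: le_trans (ler_normB _ _) _; apply: le_trans kP.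
  have := small x; have := small y.
  have -> : 4 * C * (mdist x x0 + mdist y x0) / 2 ^+ k =
    4 * (C / 2 ^+ k) * mdist x x0 + 4 * (C / 2 ^+ k) * mdist y x0.
    by rewrite mulrDr mulrDl !mulrA; congr (_ + _); rewrite mulrAC.
  by move=> ? ?; exact: lerD.
exists F; split.
- apply: approx_totally_bounded => eps e0.
  have K0 : 0 <= 4 * C by rewrite mulr_ge0.
  have [n nP] := geometric_small K0 e0.
  exists (slopes setT (S n)) => // _ [x [y [_ _ xy ->]]].
  exists ((mdist x y)^-1 *: (S n x - S n y)); first by exists x, y.
  have := slope_norm_le (Flip n) I I xy; rewrite -mulrA in nP.
  move=> /le_trans /(_ nP); congr (`|_| <= _).
  by rewrite -scalerBr !fctE; congr (_ *: _); rewrite opprD addrACA -opprD.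
- by have := Flip 0%N; rewrite expr0 divr1.
- move=> x Nx; apply/eqP; rewrite -subr_eq0 -normr_le0; apply/ler_addgt0Pr => eps e0.
  (* The 5 is 4 for [F - S n] plus 1 for [f - S n]. *)
  have K0 : 0 <= 5 * C * mdist x x0 by rewrite !mulr_ge0// mdist_ge0.
  have [n nP] := geometric_small K0 e0; rewrite add0r; apply: le_trans nP.
  have h1 := FS n x.
  have h2 : `|f x - S n x| <= C / 2 ^+ n * mdist x x0.
    have := lipschitz_with_base (fS n) Nx Nx0.
    by rewrite !fctE fx0 Sx0 subrr => /(_ erefl).
  have -> : F x - f x = (F x - S n x) - (f x - S n x).
    by rewrite opprB addrA subrK.
  apply: le_trans (ler_normB _ _) _.
  have -> : 5 * C * mdist x x0 / 2 ^+ n =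
    4 * (C / 2 ^+ n) * mdist x x0 + C / 2 ^+ n * mdist x x0.
    by field; rewrite expf_neq0// pnatr_eq0.
  exact: lerD.
Qed.

End Series.

(** * Exact extension, with a lossy and then with the sharp constant *)

Section Extension.
Variables (R : realType) (X : completeNormedModType R) (M : metricType R).
Variables (hX : L1_predual X) (N : set M) (x0 : M).
Hypothesis Nx0 : N x0.

(** Each step takes excess 1 and halves the error constant, so the corrections have constants
    [2 * (C / 2 ^+ n)], of sum [4 * C]. *)
Lemma loose_extension (f : M -> X) (C : R) : 0 < C -> f x0 = 0 ->
  lipschitz_with N C f -> totally_bounded (slopes N f) ->
  exists F : M -> X, [/\ totally_bounded (slopes setT F),
    lipschitz_with setT (4 * C) F & forall x, N x -> F x = f x].
Proof.
move=> C0 fx0 fC tf.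
pose good n (S : M -> X) := [/\ totally_bounded (slopes setT S), S x0 = 0 &
  lipschitz_with N (C / 2 ^+ n) (f - S)].
have Cn n : 0 < C / 2 ^+ n by rewrite divr_gt0// exprn_gt0.
(* Dependent choice: [step] is defined on all pairs, and its guarantee is conditional on the
   invariant [good]. *)
have /choice [step stepP] (nS : nat * (M -> X)) : exists S', good nS.1 nS.2 ->
    good nS.1.+1 S' /\ lipschitz_with setT (2 * (C / 2 ^+ nS.1)) (S' - nS.2).
  case: nS => n S /=; have [[tS Sx0 fS]|?] := pselect (good n S); last by exists S.
  have fSx0 : (f - S) x0 = 0 by rewrite !fctE fx0 Sx0 subrr.
  have tfS : totally_bounded (slopes N (f - S)).
    apply: slopes_totally_boundedB => //.
    exact: sub_totally_bounded (sub_slopes _) tS.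
  have [G [tG Gx0 Glip fG]] := approximate_extension hX Nx0 (ltW (Cn n)) ltr01
    (Cn n.+1) fSx0 fS tfS.
  exists (S + G) => _; split; last by rewrite addrC addKr.
  split; [exact: slopes_totally_boundedD|by rewrite !fctE Sx0 Gx0 addr0|].
  by rewrite opprD addrA.
pose S n := iteri n (fun k s => step (k, s)) 0.
have good0 : good 0%N (0 : M -> X).
  split => //; last by rewrite subr0 expr0 divr1.
  move=> eps e0; exists [:: 0] => _ [x [y [_ _ _ ->]]].
  by exists 0; rewrite ?inE// [X in _ *: X](_ : _ = 0 - 0)// subrr scaler0 subrr normr0 ltW.
have goodS n : good n (S n).
  by elim: n => // n IH; exact: (stepP (n, S n) IH).1.
have [|||||||F [tF Flip Ff]] := @series_extension R X M N x0 f C S.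
- exact: ltW.
- exact: Nx0.
- exact: fx0.
- by move=> n; case: (goodS n).
- by move=> n; case: (goodS n).
- by move=> n; case: (goodS n).
- by move=> n; exact: (stepP (n, S n) (goodS n)).2.
by exists F; split => //; rewrite -[F]subr0.
Qed.

End Extension.

Theorem theorem3p1 (R : realType) (X : completeNormedModType R)
    (hX : L1_predual X) (M : metricType R) (N : set M) (hN : N !=set0)
    (f : M -> X) (hf : lipschitz_compact N f) (e : R) (he : 0 < e) :
  exists F : M -> X,
    [/\ lipschitz_compact setT F,
        forall x, N x -> F x = f x
      & lipschitz_norm setT F <= (1 + e) * lipschitz_norm N f].
Proof.
have [x0 Nx0] := hN; have [lf /precompact_totally_bounded tf] := hf.
set L := lipschitz_norm N f.
have fL : lipschitz_with N L f by exact: lipschitz_with_norm.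
have L0 : 0 <= L by exact: lipschitz_norm_ge0.
suff [F [tF Flip Ff]] : exists F : M -> X, [/\ totally_bounded (slopes setT F),
    lipschitz_with setT ((1 + e) * L) F & forall x, N x -> F x = f x].
  exists F; split => //; last first.
    by apply: lipschitz_norm_le => //; rewrite mulr_ge0// addr_ge0// ltW.
  split; last exact: totally_bounded_precompact.
  by exists ((1 + e) * L) => x y _ _; exact: Flip.
(* If [L = 0], [f] is constant on [N]. The tolerance used in the other case is proportional to [L]
   and must be positive. *)
have [L00|Ln0] := eqVneq L 0.
  exists (cst (f x0)); split.
  - move=> eps e0; exists [:: 0] => _ [x [y [_ _ _ ->]]].
    by exists 0; rewrite ?inE// /cst subrr scaler0 subrr normr0 ltW.
  - by move=> x y _ _; rewrite /cst subrr normr0 L00 mulr0 mul0r.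
  - move=> x Nx; apply/esym/eqP; rewrite -subr_eq0 -normr_le0.
    by have := fL _ _ Nx Nx0; rewrite L00 mul0r.
have Lp : 0 < L by rewrite lt_neqAle eq_sym Ln0.
(* Subtracting [f x0] leaves the slopes unchanged and gives the vanishing at the base point. *)
pose h : M -> X := fun x => f x - f x0.
have hB x y : h x - h y = f x - f y by rewrite /h opprB addrA subrK.
have hx0 : h x0 = 0 by rewrite /h subrr.
have hL : lipschitz_with N L h by move=> x y Nx Ny; rewrite hB fL.
have th : totally_bounded (slopes N h).
  apply: sub_totally_bounded tf => _ [x [y [Nx Ny xy ->]]].
  by exists x, y; rewrite hB.
have e2 : 0 < e / 2 by rewrite divr_gt0.
(* The loose extension multiplies this by 4, which costs [e * L / 2]; the other half of the excess
   is spent on [G]. *)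
have d0 : 0 < e * L / 8 by rewrite divr_gt0// mulr_gt0.
have [G [tG Gx0 Glip hG]] := approximate_extension hX Nx0 L0 e2 d0 hx0 hL th.
have hGx0 : (h - G) x0 = 0 by rewrite !fctE hx0 Gx0 subrr.
have thG : totally_bounded (slopes N (h - G)).
  apply: slopes_totally_boundedB => //.
  exact: sub_totally_bounded (sub_slopes _) tG.
have [H [tH Hlip HE]] := loose_extension hX Nx0 d0 hGx0 hG thG.
pose F x := (G + H) x + f x0.
have FB x y : F x - F y = (G + H) x - (G + H) y by rewrite /F opprD addrACA subrr addr0.
exists F; split.
- apply: sub_totally_bounded (slopes_totally_boundedD tG tH) => _ [x [y [_ _ xy ->]]].
  by exists x, y; rewrite FB.
- have -> : (1 + e) * L = (1 + e / 2) * L + 4 * (e * L / 8) by field.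
  by move=> x y _ _; rewrite FB; exact: lipschitz_withD Glip Hlip x y I I.
- by move=> x Nx; rewrite /F !fctE HE// !fctE addrC [G x + _]addrC subrK /h addrC subrK.
Qed.
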